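(* Suppose $X$ is transient and define for any $y\in(\ell,r)$ the Azéma submartingale $$Z^y_t=P^x(\Lambda^y\le t\mid\mathcal F_t).$$ Then the following statements are valid. (1) Suppose $s(\ell)=-\infty$. If $g\in\mathcal S$ is non-constant and non-decreasing, then $$g(X_t)=g(\ell)+\int_\ell^r Z^y_t\,\mu(dy),$$ where $\mu$ is a Radon measure with $\mu(\{\ell,r\})=0$. (2) Suppose $s(r)=\infty$. If $g\in\mathcal S$ is non-constant and non-increasing, then $$g(X_t)=g(r)+\int_\ell^r Z^y_t\,\mu(dy),$$ where $\mu$ is a Radon measure with $\mu(\{\ell,r\})=0$.
   Context: Let $-\infty\le\ell<r\le\infty$ and let $X=(\Omega,\mathcal F,\mathcal F_t,X_t,\theta_t,P^x)$ be a regular one-dimensional diffusion on $(\ell,r)$ with no killing inside $(\ell,r)$ and absorbing boundaries, lifetime $\zeta=\inf\{t>0:X_t\in\{\ell,r\}\}$, and strictly increasing continuous scale function $s$, extended to $\ell,r$ by limits. $(\mathcal F_t)$ is the right-continuous universally completed natural filtration; $T_{ab}$ is the exit time from $(a,b)$. For $y\in(\ell,r)$, $\Lambda^y:=\sup\{0<t<\zeta:X_t=y\}$ is the last passage time at $y$, with $\sup\emptyset=0$. A Borel function $g:(\ell,r)\to\mathbb R$ is subharmonic if for every $x\in(\ell,r)$, the stopped process $g(X^{T_{ab}})$ is a uniformly integrable $P^x$-submartingale whenever $\ell<a<b<r$. $\mathcal S$ is the class of non-negative subharmonic functions; such functions are $s$-convex and are extended to $\ell,r$ by continuity. $x\in(\ell,r)$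 denotes the (arbitrary) starting point of $X$. *)

(* Defs.v *)
From HB Require Import structures.
From mathcomp Require Import all_boot all_order all_algebra.
From mathcomp Require Import all_classical all_reals all_analysis measurable_realfun.

Set Implicit Arguments.
Unset Strict Implicit.
Unset Printing Implicit Defensive.

Import Order.TTheory GRing.Theory Num.Theory.
Import numFieldNormedType.Exports.

Local Open Scope classical_set_scope.
Local Open Scope ring_scope.
Local Open Scope ereal_scope.

(* The open interval (l, r), as a set of reals. *)
Definition dom (R : realType) (l r : \bar R) : set R :=
  [set u : R | l < u%:E < r].

(* The extension to [l, r] of a function on (l, r) by its limits at l and r,
   taken in the extended reals. *)
Definition ext (R : realType) (l r : \bar R) (f : R -> R) (z : \bar R)
    : \bar R :=
  if l < z < r then (f (fine z))%:E
  else lim ((f (fine u))%:E @[u --> within [set u | l < u < r] (nbhs z)]).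

Section Paths.
Variables (R : realType) (Omega : Type) (l r : \bar R).
(* Times are reals t with 0 <= t; X t for t < 0 is never used. *)
Variable X : R -> Omega -> \bar R.

Definition lifetime (w : Omega) : \bar R :=
  ereal_inf [set t%:E | t in [set t : R | (0 < t)%R /\ (X t w = l \/ X t w = r)]].

Definition hitting_time (y : R) (w : Omega) : \bar R :=
  ereal_inf [set t%:E | t in [set t : R | (0 <= t)%R /\ X t w = y%:E]].

Definition exit_time (a b : R) (w : Omega) : \bar R :=
  ereal_inf [set t%:E | t in
    [set t : R | (0 <= t)%R /\ ~ (a%:E < X t w < b%:E)]].

(* All the times in the second set are positive, so that adjoining 0 only
   implements the convention that the supremum of the empty set is 0. *)
Definition last_passage (y : R) (w : Omega) : \bar R :=
  ereal_sup ([set 0] `|` [set t%:E | t in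
    [set t : R | [/\ (0 < t)%R, t%:E < lifetime w & X t w = y%:E]]]).

Definition natural_filtration (t : R) : set (set Omega) :=
  <<s [set A | exists u (B : set (\bar R)),
    [/\ (0 <= u <= t)%R, measurable B & A = X u @^-1` B]] >>.

Definition natural_sigma_algebra : set (set Omega) :=
  <<s [set A | exists u (B : set (\bar R)),
    [/\ (0 <= u)%R, measurable B & A = X u @^-1` B]] >>.

End Paths.

Section ConditionalExpectation.
Variables (R : realType) (d : measure_display) (Omega : measurableType d).
Variable P : probability Omega R.

Definition adapted_to (G : set (set Omega)) (W : Omega -> R) : Prop :=
  forall B : set R, measurable B -> G (W @^-1` B).

(* W is a version of E[Y | G]. *)
Definition is_cond_exp (G : set (set Omega)) (Y W : Omega -> R) : Prop :=
  [/\ adapted_to G W,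
      P.-integrable setT (EFin \o W) &
      forall A, G A ->
        \int[P]_(w in A) (W w)%:E = \int[P]_(w in A) (Y w)%:E].

(* W is a version of P(E | G). *)
Definition is_cond_prob (G : set (set Omega)) (E : set Omega)
    (W : Omega -> R) : Prop :=
  is_cond_exp G \1_E W.

Definition submartingale (F : R -> set (set Omega)) (M : R -> Omega -> R)
    : Prop :=
  (forall t, (0 <= t)%R ->
     adapted_to (F t) (M t) /\ P.-integrable setT (EFin \o M t)) /\
  (forall u t, (0 <= u <= t)%R ->
     exists2 W, is_cond_exp (F u) (M t) W &
       {ae P, forall w, (M u w <= W w)%R}).

Definition uniformly_integrable (M : R -> Omega -> R) : Prop :=
  forall e : R, (0 < e)%R -> exists K : R, forall t, (0 <= t)%R ->
    \int[P]_(w in [set w | (K < `|M t w|)%R]) (`|M t w|%R)%:E <= e%:E.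

End ConditionalExpectation.

Section Diffusion.
Variables (R : realType) (d : measure_display) (Omega : measurableType d).
Variables (l r : \bar R) (X : R -> Omega -> \bar R).
Variables (theta : R -> Omega -> Omega) (P : R -> probability Omega R).

(* The law P^nu of the process with initial distribution nu; used only on
   natural_sigma_algebra X, where z |-> P z A is Borel. *)
Definition initial_law (nu : probability R R) (A : set Omega) : \bar R :=
  \int[nu]_(z in dom l r) P z A.

(* The sets that, for each initial distribution nu on (l, r), differ from a
   member of G by a subset of a P^nu-null set of the natural sigma-algebra. *)
Definition universal_completion (G : set (set Omega)) : set (set Omega) :=
  [set A | forall nu : probability R R, nu (dom l r) = 1 ->
     exists B N, [/\ G B, natural_sigma_algebra X N, initial_law nu N = 0 &
                     (A `\` B) `|` (B `\` A) `<=` N]].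

Definition filtration (t : R) : set (set Omega) :=
  [set A | forall u : R, (t < u)%R ->
     universal_completion (natural_filtration X u) A].

Definition stopping_time (T : Omega -> \bar R) : Prop :=
  (forall w, 0 <= T w) /\
  (forall t : R, (0 <= t)%R -> filtration t [set w | T w <= t%:E]).

Definition stopped_sigma_algebra (T : Omega -> \bar R) : set (set Omega) :=
  [set A | measurable A /\
     forall t : R, (0 <= t)%R -> filtration t (A `&` [set w | T w <= t%:E])].

(* The family P is indexed by the interior starting points only: after the
   lifetime the path is frozen at l or r, so the strong Markov property has
   content only on {T < lifetime}, where X_T lies in (l, r).  Killing inside
   (l, r) is excluded, as X t w is in [l, r] and continuous for all times. *)
Record regular_diffusion : Prop := RegularDiffusion {
  diff_range : forall t w, (0 <= t)%R -> l <= X t w <= r;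
  diff_continuous : forall w,
    {within [set t : R | (0 <= t)%R], continuous (fun t => X t w)};
  diff_absorbing : forall u t w, (0 <= u <= t)%R ->
    X u w = l \/ X u w = r -> X t w = X u w;
  diff_shift : forall u t w, (0 <= u)%R -> (0 <= t)%R ->
    X u (theta t w) = X (t + u)%R w;
  diff_sigma_algebra : forall A : set Omega,
    measurable A <-> universal_completion (natural_sigma_algebra X) A;
  diff_start : forall x, dom l r x -> P x [set w | X 0%R w = x%:E] = 1;
  diff_kernel : forall A, natural_sigma_algebra X A ->
    measurable_fun (dom l r) (fun z => P z A);
  diff_strong_markov : forall x, dom l r x ->
    forall T, stopping_time T ->
    forall A, stopped_sigma_algebra T A ->
    forall B, natural_sigma_algebra X B ->
    P x (A `&` [set w | T w < lifetime l r X w]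
           `&` [set w | B (theta (fine (T w)) w)]) =
    \int[P x]_(w in A `&` [set w | T w < lifetime l r X w])
      P (fine (X (fine (T w)) w)) B;
  diff_regular : forall x y, dom l r x -> dom l r y ->
    0 < P x [set w | hitting_time X y w < +oo]
}.

Definition scale_function (s : R -> R) : Prop :=
  [/\ {in dom l r &, forall u v, (u < v)%R -> (s u < s v)%R},
      {within dom l r, continuous s} &
      forall a x b, dom l r a -> dom l r b -> (a < x < b)%R ->
        P x [set w | hitting_time X b w < hitting_time X a w] =
        ((s x - s a) / (s b - s a))%:E].

Definition recurrent : Prop :=
  forall x y, dom l r x -> dom l r y ->
    P x [set w | hitting_time X y w < +oo] = 1.

Definition transient : Prop := ~ recurrent.

(* The stopped process has its values in (l, r) almost surely, so that the
   values of g outside (l, r) are irrelevant. *)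
Definition subharmonic (g : R -> R) : Prop :=
  measurable_fun (dom l r) g /\
  forall x, dom l r x -> forall a b : R, l < a%:E -> (a < b)%R -> b%:E < r ->
    let M := fun (t : R) (w : Omega) =>
      g (fine (X (fine (mine t%:E (exit_time X a b w))) w)) in
    submartingale (P x) filtration M /\ uniformly_integrable (P x) M.

Definition nonneg_subharmonic (g : R -> R) : Prop :=
  subharmonic g /\ forall u, dom l r u -> (0 <= g u)%R.

(* Z y t is a version of P^x(last_passage y <= t | F_t), chosen right-continuous
   in t as usual, and jointly measurable in (y, w), without which the integral
   of y |-> Z y t w against a measure need not make sense. *)
Definition azema_submartingales (x : R) (Z : R -> R -> Omega -> R) : Prop :=
  [/\ forall y t, dom l r y -> (0 <= t)%R ->
        is_cond_prob (P x) (filtration t)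
          [set w | last_passage l r X y w <= t%:E] (Z y t),
      forall y t w, dom l r y -> (0 <= t)%R ->
        Z y u w @[u --> t^'+] --> Z y t w &
      forall t, (0 <= t)%R ->
        measurable_fun (dom l r `*` setT)
          (fun yw : R * Omega => Z yw.1 t yw.2)].

End Diffusion.

(* A Borel measure on the extended line, considered as a measure on [l, r],
   that is Radon on (l, r): it is finite on the compact subsets of (l, r). *)
Definition radon (R : realType) (l r : \bar R)
    (mu : {measure set (\bar R) -> \bar R}) : Prop :=
  forall K : set (\bar R), compact K -> K `<=` [set y | l < y < r] ->
    mu K < +oo.

(* Main.v *)
Require Import Defs.
From HB Require Import structures.
From mathcomp Require Import all_boot all_order all_algebra.
From mathcomp Require Import all_classical all_reals all_analysis measurable_realfun.
From mathcomp Require Import ring lra.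

Set Implicit Arguments.
Unset Strict Implicit.
Unset Printing Implicit Defensive.

Import Order.TTheory GRing.Theory Num.Theory.
Import numFieldNormedType.Exports.

Local Open Scope classical_set_scope.
Local Open Scope ring_scope.
Local Open Scope ereal_scope.

(** Suppose s(l) = -oo; the case s(r) = +oo is its mirror image.

For z < y the scale formula for exits from (a, y) gives, as a tends to l, that
the diffusion started at z visits y almost surely. If s were also unbounded at
r, the same would hold from the other side and X would be recurrent; hence S,
the supremum of s, is finite, and from z > y the diffusion escapes to r without
visiting y with probability (s z - s y) / (S - s y) ([no_return_prob_right]).
By the Markov property at the fixed time t, a version of Z^y_t is therefore
  phi y (X_t),   where   phi y z = max 0 ((s z - s y) / (S - s y)),
read as 1 once the path is absorbed ([azema_version], [escape_prob]).

The submartingale property of g, stopped at exits from intervals, says that g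
is convex in the scale s ([subharmonic_scale_convex]). A convex function which
is nondecreasing and bounded below on a half-line unbounded to the left is a
constant plus a superposition of the functions z |-> (s z - s y)^+, that is, of
the functions phi y ([convex_superposition]). The representing measure is
constructed as the image of Lebesgue measure on an interval of heights p: the
tangent line to g (drawn in the scale s) that passes through the point of
abscissa S and height c + p, with c = g(l), touches the graph over the point
q p, and g z = c + \int phi (q p) z dp. The total mass is the increment of g
from l to r, which gives the identity after absorption as well.

It remains to substitute Z^y_t for phi y (X_t) under the integral. The two agree
almost surely for each y and t; by Fubini, almost surely they agree at all
rational times for almost every y, hence at all times, as both are
right-continuous ([ae_match], [representation]). *)

(** * Real analysis *)

Section RealAnalysis.
Variable R : realType.
Implicit Types (D : set R) (f F : R -> R).

Lemma nondecreasing_on_measurable D f : is_interval D ->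
  (forall u v, D u -> D v -> (u <= v)%R -> (f u <= f v)%R) ->
  measurable_fun D f.
Proof.
move=> iD fD; apply: (measurability (@RGenOInfty.G R)).
  exact: RGenOInfty.measurableE.
move=> _ [_ [a ->] <-]; apply: is_interval_measurable => u v [Du ua] [Dv va] z.
move=> /andP[uz zv]; have Dz : D z by apply: (iD u v) => //; rewrite uz.
split=> //=; move: ua => /=; rewrite !in_itv/= !andbT => ua.
by apply: (lt_le_trans ua); apply: fD.
Qed.

Lemma nonincreasing_on_measurable D f : is_interval D ->
  (forall u v, D u -> D v -> (u <= v)%R -> (f v <= f u)%R) ->
  measurable_fun D f.
Proof.
move=> iD fD; have -> : f = (-%R \o (fun u => - f u))%R.
  by apply/funext => u /=; rewrite opprK.
apply: measurableT_comp; first exact: oppr_measurable.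
by apply: nondecreasing_on_measurable => // u v Du Dv uv; rewrite lerN2 fD.
Qed.

Lemma le_vanishing (e K : R) : (forall n : nat, (e <= K / 2 ^+ n)%R) ->
  (e <= 0)%R.
Proof.
move=> eK; rewrite leNgt; apply/negP => e0.
have K0 : (0 < K)%R by apply: (lt_le_trans e0); have := eK 0%N; rewrite expr0 divr1.
have := @archi_boundP R (K / e)%R; rewrite divr_ge0 ?ltW// => /(_ isT).
set n := Num.bound _ => Kn; have := eK n; apply/negP; rewrite -ltNge.
rewrite ltr_pdivrMr ?exprn_gt0// mulrC -ltr_pdivrMr//.
by rewrite (lt_trans Kn)// -natrX ltr_nat ltn_expl.
Qed.

(** Two additive interval functions which both lie between the lower and the
upper Darboux sums of f with respect to F coincide: halving the oscillation of
f along a partition also halves the gap between those sums. *)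
Lemma darboux_unique D f F (I J : R -> R -> R) :
  (forall a b c, D a -> D b -> D c -> (a <= b <= c)%R ->
    I a c = (I a b + I b c)%R /\ J a c = (J a b + J b c)%R) ->
  (forall a b, D a -> D b -> (a <= b)%R ->
    (f b * (F b - F a) <= I a b <= f a * (F b - F a))%R /\
    (f b * (F b - F a) <= J a b <= f a * (F b - F a))%R) ->
  (forall a b, D a -> D b -> (a <= b)%R ->
    exists2 c, D c & (a <= c <= b)%R /\ f c = ((f a + f b) / 2)%R) ->
  forall a b, D a -> D b -> (a <= b)%R -> I a b = J a b.
Proof.
move=> add bnd mid.
have gap n : forall a b, D a -> D b -> (a <= b)%R ->
    (`|I a b - J a b| <= (f a - f b) * (F b - F a) / 2 ^+ n)%R.
  elim: n => [|n IH] a b Da Db ab.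
    have [/andP[? ?] /andP[? ?]] := bnd _ _ Da Db ab.
    by rewrite expr0 divr1 ler_norml; apply/andP; split; lra.
  have [c Dc [/andP[ac cb] fc]] := mid _ _ Da Db ab.
  have [-> ->] : I a b = (I a c + I c b)%R /\ J a b = (J a c + J c b)%R.
    by apply: add => //; rewrite ac.
  have := IH _ _ Da Dc ac; have := IH _ _ Dc Db cb; rewrite fc.
  have -> : (I a c + I c b - (J a c + J c b) =
    (I a c - J a c) + (I c b - J c b))%R by ring.
  move=> h1 h2; apply: (le_trans (ler_normD _ _)); apply: (le_trans (lerD h2 h1)).
  rewrite exprS invfM; lra.
move=> a b Da Db ab; apply/eqP; rewrite -subr_eq0 -normr_eq0 eq_le normr_ge0 andbT.
by apply: (@le_vanishing _ ((f a - f b) * (F b - F a)))=> n; exact: gap.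
Qed.

Lemma lebesgue_measure_oc (a b : R) : (a <= b)%R ->
  lebesgue_measure (`]a, b] : set R) = (b - a)%:E.
Proof.
move=> ab; rewrite lebesgue_measure_itv/= lte_fin; case: ltP => // ba.
by have -> : a = b; [apply/le_anti; rewrite ab|rewrite subrr].
Qed.

Lemma lebesgue_measure_sub_oc (A : set R) (a b : R) : measurable A ->
  (a <= b)%R -> A `<=` `]a, b]%classic -> lebesgue_measure A <= (b - a)%:E.
Proof.
move=> mA ab Aab; rewrite -(lebesgue_measure_oc ab).
by apply: le_measure => //; rewrite inE.
Qed.

Lemma integral_itv_bounded (h : R -> R) (a b m M : R) : (a <= b)%R ->
  measurable_fun `]a, b] h -> (0 <= m)%R ->
  (forall p, (a < p <= b)%R -> (m <= h p <= M)%R) ->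
  (m * (b - a))%:E <= \int[lebesgue_measure]_(p in `]a, b]) (h p)%:E
    <= (M * (b - a))%:E.
Proof.
move=> ab mh m0 hb.
have len := lebesgue_measure_oc ab.
have itv p : `]a, b]%classic p -> (m <= h p <= M)%R.
  by rewrite /= in_itv/= => /hb.
rewrite !EFinM -!len -!integral_cst//; apply/andP; split.
  apply: ge0_le_integral => //; first exact/measurable_EFinP.
  by move=> p /itv /andP[? ?]; rewrite lee_fin.
apply: ge0_le_integral => //.
- by move=> p /itv /andP[? ?]; rewrite lee_fin (le_trans m0).
- exact/measurable_EFinP.
- by move=> p /itv /andP[? ?]; rewrite lee_fin.
Qed.

End RealAnalysis.

(** The probability that a diffusion with scale s started at z escapes to the
boundary point where s tends to the finite value S without visiting y. The
quotient keeps its form under reflection of the scale, so that S may be the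
supremum or the infimum of s. *)
Definition escape_prob (R : realType) (s : R -> R) (S y z : R) : R :=
  Num.max 0%R ((s z - s y) / (S - s y))%R.

(** The representing measure is carried by a pair (E, q), as the image under q
of Lebesgue measure on E. In this form it may have infinite mass at a boundary
point, and a reflection only changes the sign of q. *)
Definition superposition (R : realType) (D : set R) (phi : R -> R -> R)
    (g : R -> R) (c : R) (E : set R) (q : R -> R) : Prop :=
  [/\ measurable E, measurable_fun E q, forall p, E p -> D (q p),
      forall a b, D a -> D b ->
        lebesgue_measure (E `&` [set p | (a <= q p <= b)%R]) < +oo &
      (forall z, D z -> (g z)%:E =
        c%:E + \int[lebesgue_measure]_(p in E) (phi (q p) z)%:E) /\
      ereal_sup [set (g z)%:E | z in D] = c%:E + lebesgue_measure E].

Section ConvexRepresentation.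
Variables (R : realType) (l r : \bar R) (s g : R -> R) (S c : R).
Local Notation D := (dom l r).
Local Notation phi := (escape_prob s S).
Hypotheses
  (s_incr : forall u v, D u -> D v -> (u < v)%R -> (s u < s v)%R)
  (s_ivt : forall a b v, D a -> D b -> (a <= b)%R -> (s a <= v <= s b)%R ->
    exists2 y, (a <= y <= b)%R & s y = v)
  (s_lt : forall u, D u -> (s u < S)%R)
  (s_sup : forall e : R, (0 < e)%R -> exists2 u, D u & (S - e < s u)%R)
  (s_unbounded : forall M : R, exists2 u, D u & (s u < M)%R)
  (g_nondecr : forall u v, D u -> D v -> (u <= v)%R -> (g u <= g v)%R)
  (g_convex : forall a x b, D a -> D x -> D b -> (a < x < b)%R ->
    (g x * (s b - s a) <= g a * (s b - s x) + g b * (s x - s a))%R)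
  (g_ge : forall u, D u -> (c <= g u)%R)
  (g_inf : forall e : R, (0 < e)%R -> exists2 u, D u & (g u < c + e)%R).

Lemma dom_interval : is_interval D.
Proof.
move=> u v /andP[lu _] /andP[_ vr] w /andP[uw wv]; apply/andP; split.
  by rewrite (lt_le_trans lu)// lee_fin.
by rewrite (le_lt_trans _ vr)// lee_fin.
Qed.

Lemma s_nondecr u v : D u -> D v -> (u <= v)%R -> (s u <= s v)%R.
Proof.
move=> Du Dv; rewrite le_eqVlt => /orP[/eqP -> //|uv].
by rewrite ltW// s_incr.
Qed.

Lemma s_lt_inv u v : D u -> D v -> (s u < s v)%R -> (u < v)%R.
Proof.
move=> Du Dv suv; rewrite ltNge; apply/negP => /(s_nondecr Dv Du).
by rewrite leNgt suv.
Qed.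

Lemma dom_above u : D u -> exists2 v, D v & (u < v)%R.
Proof.
move=> Du; have [|v Dv] := s_sup (e := (S - s u)%R).
  by rewrite subr_gt0 s_lt.
by rewrite opprB addrC subrK => /(s_lt_inv Du Dv); exists v.
Qed.

Definition slope u v : R := ((g v - g u) / (s v - s u))%R.

Definition right_slope u : R := inf [set slope u v | v in [set v | D v /\ (u < v)%R]].
Local Notation d := right_slope.

Lemma slope_ge0 u v : D u -> D v -> (u < v)%R -> (0 <= slope u v)%R.
Proof.
move=> Du Dv uv; rewrite divr_ge0 ?subr_ge0//.
  by rewrite g_nondecr// ltW.
by rewrite ltW// s_incr.
Qed.

Lemma right_slope_le u v : D u -> D v -> (u < v)%R -> (d u <= slope u v)%R.
Proof.
move=> Du Dv uv; apply: ge_inf; last by exists v.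
by exists 0%R => _ [w [Dw uw] <-]; exact: slope_ge0.
Qed.

Lemma le_right_slope u x : D u -> 
  (forall v, D v -> (u < v)%R -> (x <= slope u v)%R) -> (x <= d u)%R.
Proof.
move=> Du xle; apply: lb_le_inf.
  by have [v Dv uv] := dom_above Du; exists (slope u v), v.
by move=> _ [w [Dw uw] <-]; exact: xle.
Qed.

Lemma right_slope_ge0 u : D u -> (0 <= d u)%R.
Proof. by move=> Du; apply: le_right_slope => // v Dv; exact: slope_ge0. Qed.

Lemma increment_bounds u v : D u -> D v -> (u <= v)%R ->
  (d u * (s v - s u) <= g v - g u <= d v * (s v - s u))%R.
Proof.
move=> Du Dv; rewrite le_eqVlt => /orP[/eqP ->|uv].
  by rewrite !subrr !mulr0 lexx.
have suv := s_incr Du Dv uv; have suv0 : (0 < s v - s u)%R by rewrite subr_gt0.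
apply/andP; split; first by rewrite -ler_pdivlMr//; exact: right_slope_le.
rewrite -ler_pdivrMr//.
apply: le_right_slope => // w Dw vw; have svw := s_incr Dv Dw vw.
have uvw : (u < v < w)%R by rewrite uv.
have cvx := g_convex Du Dv Dw uvw.
rewrite /slope ler_pdivrMr// mulrAC ler_pdivlMr ?subr_gt0//; nra.
Qed.

Lemma right_slope_nondecr u v : D u -> D v -> (u <= v)%R -> (d u <= d v)%R.
Proof.
move=> Du Dv; rewrite le_eqVlt => /orP[/eqP -> //|uv].
have := increment_bounds Du Dv (ltW uv) => /andP[h1 h2].
by rewrite -(ler_pM2r (x := (s v - s u)%R)) ?(le_trans h1)// subr_gt0 s_incr.
Qed.

(** The height above c at which the tangent line at y, drawn in the scale s,
meets the vertical line at S. Formally its differential is (S - s) times that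
of the slope, so it is the distribution function of the representing measure. *)
Definition tangent_height y : R := (g y - c + (S - s y) * d y)%R.
Local Notation F := tangent_height.

Lemma tangent_height_ge0 y : D y -> (0 <= F y)%R.
Proof.
move=> Dy; rewrite addr_ge0 ?subr_ge0 ?g_ge// mulr_ge0 ?right_slope_ge0//.
by rewrite subr_ge0 ltW// s_lt.
Qed.

Lemma tangent_height_nondecr u v : D u -> D v -> (u <= v)%R -> (F u <= F v)%R.
Proof.
move=> Du Dv uv; have /andP[h1 _] := increment_bounds Du Dv uv.
have h2 := right_slope_nondecr Du Dv uv; have h3 := s_lt Dv.
by rewrite /tangent_height; nra.
Qed.

(** For a < z the slope at a times s z - s a is at most g z - c, which is small
if z is close to the left boundary. Since s z - s a grows without bound as a
decreases, the slope itself tends to 0, and so does its contribution on the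
fixed distance S - s z. *)
Lemma tangent_height_vanish (e : R) y : (0 < e)%R -> D y ->
  exists2 a, D a & (a <= y)%R /\ (F a < e)%R.
Proof.
move=> e0 Dy; have e20 : (0 < e / 2)%R by rewrite divr_gt0.
have [y' Dy' gy'] := g_inf e20.
have [z [Dz zy gz]] : exists z, [/\ D z, (z <= y)%R & (g z < c + e / 2)%R].
  have [yy'|y'y] := leP y y'; last by exists y'; split=> //; exact: ltW.
  by exists y; split=> //; rewrite (le_lt_trans _ gy')// g_nondecr.
pose K := ((S - s z) * (g z - c + 1) / (e / 2))%R.
have Sz := s_lt Dz; have cz := g_ge Dz.
have K0 : (0 < K)%R by rewrite divr_gt0// mulr_gt0 ?subr_gt0//; lra.
have [a Da sa] := s_unbounded (s z - K).
have saz : (s a < s z)%R by lra.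
have az := s_lt_inv Da Dz saz.
exists a => //; split; first by rewrite (le_trans (ltW az)).
have /andP[h1 _] := increment_bounds Da Dz (ltW az).
have ca := g_ge Da; have d0 := right_slope_ge0 Da.
have h2 : (d a * K < g z - c + 1)%R by nra.
have h3 : ((S - s z) * d a < e / 2)%R.
  rewrite -(ltr_pM2r K0) -mulrA.
  apply: (@lt_le_trans _ _ ((S - s z) * (g z - c + 1))%R).
    by rewrite ltr_pM2l ?subr_gt0.
  by rewrite /K [leRHS]mulrC divfK// gt_eqF.
by rewrite /tangent_height; nra.
Qed.

Definition heights : set R := [set p | (0 < p)%R /\ exists2 y, D y & (p <= F y)%R].
Local Notation E := heights.

(** The generalized inverse of the tangent height. *)
Definition tangent_point p : R := inf [set y | D y /\ (p <= F y)%R].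
Local Notation q := tangent_point.

Lemma tangent_point_bounds a b p : D a -> D b -> (F a < p <= F b)%R ->
  (a <= q p <= b)%R.
Proof.
move=> Da Db /andP[ap pb].
have lb : lbound [set y | D y /\ (p <= F y)%R] a.
  move=> y [Dy py]; rewrite leNgt; apply/negP => ya.
  have := tangent_height_nondecr Dy Da (ltW ya).
  by apply/negP; rewrite -ltNge (lt_le_trans ap).
apply/andP; split; first by apply: lb_le_inf => //; exists b.
by apply: ge_inf => //; exists a.
Qed.

Lemma heights_bracket p : E p -> exists a b,
  [/\ D a, D b & (F a < p <= F b)%R].
Proof.
move=> [p0 [b Db pb]]; have [a Da [_ ap]] := tangent_height_vanish p0 Db.
by exists a, b; rewrite ap.
Qed.

Lemma tangent_point_dom p : E p -> D (q p).
Proof.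
move=> /heights_bracket[a [b [Da Db ab]]].
exact: (dom_interval Da Db (tangent_point_bounds Da Db ab)).
Qed.

Lemma heights_itv a b : D a -> D b -> `]F a, F b]%classic `<=` E.
Proof.
move=> Da Db p; rewrite /= in_itv/= => /andP[ap pb]; split; last by exists b.
by rewrite (le_lt_trans _ ap)// tangent_height_ge0.
Qed.

Lemma heights_interval : is_interval E.
Proof.
move=> u v [u0 _] [_ [y Dy vy]] w /andP[uw wv]; split; first exact: lt_le_trans uw.
by exists y => //; exact: le_trans vy.
Qed.

Lemma measurable_heights : measurable E.
Proof. exact: is_interval_measurable heights_interval. Qed.

Lemma tangent_point_nondecr p p' : E p -> E p' -> (p <= p')%R -> (q p <= q p')%R.
Proof.
move=> Ep Ep' pp'; have [a [_ [Da _ /andP[ap _]]]] := heights_bracket Ep.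
have [_ [b [_ Db /andP[_ pb]]]] := heights_bracket Ep'.
apply: lb_le_inf; first by exists b.
move=> y [Dy py]; apply: ge_inf; last by split => //; exact: le_trans py.
exists a => x [Dx px]; rewrite leNgt; apply/negP => xa.
have := tangent_height_nondecr Dx Da (ltW xa).
by apply/negP; rewrite -ltNge (lt_le_trans ap).
Qed.

Lemma tangent_point_measurable : measurable_fun E q.
Proof.
exact: nondecreasing_on_measurable heights_interval tangent_point_nondecr.
Qed.

Lemma escape_prob_ge0 y z : (0 <= phi y z)%R.
Proof. by rewrite le_max lexx. Qed.

Lemma escape_prob_eq0 y z : D y -> D z -> (z <= y)%R -> phi y z = 0%R.
Proof.
move=> Dy Dz zy; apply/max_idPl; rewrite pmulr_lle0 ?subr_le0 ?s_nondecr//.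
by rewrite invr_gt0 subr_gt0 s_lt.
Qed.

Lemma escape_probE y z : D y -> D z -> (y <= z)%R ->
  phi y z = ((s z - s y) / (S - s y))%R.
Proof.
move=> Dy Dz yz; apply/max_idPr; rewrite divr_ge0 ?subr_ge0 ?s_nondecr//.
by rewrite ltW// s_lt.
Qed.

Lemma escape_prob_le1 y z : D y -> D z -> (phi y z <= 1)%R.
Proof.
move=> Dy Dz; rewrite ge_max ler01/= ler_pdivrMr ?subr_gt0 ?s_lt// mul1r.
by rewrite lerD2r ltW// s_lt.
Qed.

Lemma escape_prob_nonincr y y' z : D y -> D y' -> D z -> (y <= y')%R ->
  (phi y' z <= phi y z)%R.
Proof.
move=> Dy Dy' Dz yy'; have [y'z|zy'] := leP y' z; last first.
  by rewrite (escape_prob_eq0 Dy' Dz (ltW zy')) escape_prob_ge0.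
rewrite !escape_probE//; last exact: le_trans yy' y'z.
have sy := s_lt Dy; have sy' := s_lt Dy'; have sz := s_lt Dz.
have syy' := s_nondecr Dy Dy' yy'; have sy'z := s_nondecr Dy' Dz y'z.
rewrite ler_pdivrMr ?subr_gt0// mulrAC ler_pdivlMr ?subr_gt0//; nra.
Qed.

Lemma escape_prob_midpoint a b z : D a -> D b -> D z -> (a <= b <= z)%R ->
  exists2 y, D y & (a <= y <= b)%R /\ phi y z = ((phi a z + phi b z) / 2)%R.
Proof.
move=> Da Db Dz /andP[ab bz]; have az := le_trans ab bz.
set m := (_ / 2)%R; have Sz := s_lt Dz; have Sa := s_lt Da; have Sb := s_lt Db.
have sab := s_nondecr Da Db ab; have sbz := s_nondecr Db Dz bz.
have phiab := escape_prob_nonincr Da Db Dz ab.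
have ma : (m * (S - s a) <= s z - s a)%R.
  by rewrite -ler_pdivlMr ?subr_gt0// -escape_probE// /m; lra.
have mb : (s z - s b <= m * (S - s b))%R.
  by rewrite -ler_pdivrMr ?subr_gt0// -escape_probE// /m; lra.
have m1 : (0 < 1 - m)%R.
  suff : (m < 1)%R by rewrite subr_gt0.
  apply: (@le_lt_trans _ _ (phi a z)); first by rewrite /m; lra.
  by rewrite escape_probE// ltr_pdivrMr ?subr_gt0// mul1r; lra.
(* the solution v of (s z - v) / (S - v) = m *)
pose v := ((s z - m * S) / (1 - m))%R.
have vE : (v * (1 - m) = s z - m * S)%R by rewrite /v divfK// gt_eqF.
have [|y yab sy] := s_ivt (v := v) Da Db ab.
  by rewrite /v ler_pdivlMr// ler_pdivrMr//; apply/andP; split; lra.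
have Dy : D y by apply: (dom_interval Da Db).
move/andP: yab => [ay yb].
exists y => //; split; first by rewrite ay.
rewrite escape_probE ?(le_trans yb)//; have Sy := s_lt Dy.
have nz : (S - s y != 0)%R by rewrite gt_eqF// subr_gt0.
by apply: (mulIf nz); rewrite divfK// sy; lra.
Qed.

Lemma escape_prob_tangent_measurable z : D z ->
  measurable_fun E (fun p => phi (q p) z).
Proof.
move=> Dz; apply: nonincreasing_on_measurable heights_interval _ => p p' Ep Ep' pp'.
by apply: escape_prob_nonincr => //;
  [exact: tangent_point_dom..|exact: tangent_point_nondecr].
Qed.

(** The Bregman gap g z - g a - d a * (s z - s a) and the integral both satisfy
the Darboux bounds of y |-> phi y z with respect to the tangent height. *)
Lemma bregman_gap_integral a z : D a -> D z -> (a <= z)%R ->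
  \int[lebesgue_measure]_(p in `]F a, F z]) (phi (q p) z)%:E =
  (g z - g a - d a * (s z - s a))%:E.
Proof.
move=> Da Dz az.
pose Dz' := [set y | D y /\ (y <= z)%R].
pose Psi y := (g z - g y - d y * (s z - s y))%R.
pose I u v := \int[lebesgue_measure]_(p in `]F u, F v]) (phi (q p) z)%:E.
have mphi u v : D u -> D v -> measurable_fun `]F u, F v] (fun p => phi (q p) z).
  move=> Du Dv; apply: measurable_funS (escape_prob_tangent_measurable Dz).
    exact: measurable_heights.
  exact: heights_itv.
have Ibnd u v : D u -> D v -> (u <= v)%R ->
    (phi v z * (F v - F u))%:E <= I u v <= (phi u z * (F v - F u))%:E.
  move=> Du Dv uv; apply: integral_itv_bounded.
  - exact: tangent_height_nondecr.
  - exact: mphi.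
  - exact: escape_prob_ge0.
  move=> p puv; have /andP[uq qv] := tangent_point_bounds Du Dv puv.
  have Dq : D (q p) by apply: dom_interval Du Dv _ _; rewrite uq.
  by rewrite !escape_prob_nonincr.
have Ifin u v : D u -> D v -> (u <= v)%R -> (fine (I u v))%:E = I u v.
  move=> Du Dv uv; rewrite fineK//; have /andP[h1 h2] := Ibnd _ _ Du Dv uv.
  rewrite fin_numE; apply/andP; split; apply/eqP => h; move: h1 h2;
    by rewrite h.
suff : fine (I a z) = (Psi a - Psi z)%R.
  move=> h; rewrite -[LHS](Ifin _ _ Da Dz az) h /Psi; congr EFin; ring.
apply: (@darboux_unique _ Dz' (fun y => phi y z) F (fun u v => fine (I u v))
  (fun u v => (Psi u - Psi v)%R)) => //.
- move=> u v w [Du _] [Dv _] [Dw _] /andP[uv vw]; split; last by ring.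
  apply: EFin_inj; rewrite EFinD !Ifin ?(le_trans uv)//.
  rewrite /I -ge0_integral_setU//; first last.
  + rewrite disj_set2E; apply/eqP/seteqP; split=> // p [] /=; rewrite !in_itv/=.
    by move=> /andP[_ h1] /andP[h2 _]; move: (lt_le_trans h2 h1); rewrite ltxx.
  + by move=> p _; rewrite lee_fin escape_prob_ge0.
  + apply/measurable_EFinP; rewrite -itv_bndbnd_setU ?bnd_simp ?tangent_height_nondecr//.
    by apply: mphi.
  + rewrite -itv_bndbnd_setU ?bnd_simp ?tangent_height_nondecr//.
- move=> u v [Du uz] [Dv vz] uv; split.
    by rewrite -!lee_fin Ifin// Ibnd.
  rewrite !escape_probE//.
  have Su := s_lt Du; have Sv := s_lt Dv; have Sz := s_lt Dz.
  have suv := s_nondecr Du Dv uv; have svz := s_nondecr Dv Dz vz.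
  have /andP[h1 h2] := increment_bounds Du Dv uv.
  rewrite mulrAC ler_pdivrMr ?subr_gt0// mulrAC ler_pdivlMr ?subr_gt0//.
  rewrite /Psi /tangent_height.
  set du := d u in h1 h2 *; set dv := d v in h1 h2 *.
  apply/andP; split; rewrite -subr_ge0.
    set e := (X in (0 <= X)%R).
    have -> : e = ((S - s z) * ((g v - g u) - du * (s v - s u)))%R by rewrite /e; ring.
    by rewrite mulr_ge0// subr_ge0// ltW.
  set e := (X in (0 <= X)%R).
  have -> : e = ((S - s z) * (dv * (s v - s u) - (g v - g u)))%R by rewrite /e; ring.
  by rewrite mulr_ge0// subr_ge0// ltW.
- move=> u v [Du uz] [Dv vz] uv.
  have uvz : (u <= v <= z)%R by rewrite uv.
  have [y Dy [/andP[uy yv] ?]] := escape_prob_midpoint Du Dv Dz uvz.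
  by exists y; [split=> //; exact: le_trans yv vz|rewrite uy].
Qed.

Lemma tangent_point_ge p z : E p -> D z -> (F z < p)%R -> (z <= q p)%R.
Proof.
move=> [_ [b Db pb]] Dz zp; have zpb : (F z < p <= F b)%R by rewrite zp.
by have /andP[] := tangent_point_bounds Dz Db zpb.
Qed.

(** Up to the two terms bounded by the tangent height at a, which vanishes as a
tends to the left boundary, both sides are Bregman gaps at a: the heights below
that of a contribute at most its value, and those above that of z nothing. *)
Lemma convex_representation z : D z ->
  (g z)%:E = c%:E + \int[lebesgue_measure]_(p in E) (phi (q p) z)%:E.
Proof.
move=> Dz; set J := \int[lebesgue_measure]_(p in E) (phi (q p) z)%:E.
have mE := measurable_heights.
have mphi : measurable_fun E (fun p => (phi (q p) z)%:E).
  by apply/measurable_EFinP; exact: escape_prob_tangent_measurable.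
have phi0 p : 0 <= (phi (q p) z)%:E by rewrite lee_fin escape_prob_ge0.
have bracket (e : R) : (0 < e)%R -> (g z - c - e)%:E <= J <= (g z - c + e)%:E.
  move=> e0; have [a Da [az Fae]] := tangent_height_vanish e0 Dz.
  have gap := bregman_gap_integral Da Dz az.
  have Fa0 := tangent_height_ge0 Da.
  have Faz := tangent_height_nondecr Da Dz az.
  have ca := g_ge Da; have d0 := right_slope_ge0 Da.
  have sa := s_nondecr Da Dz az; have Sz := s_lt Dz.
  have da0 : (0 <= d a * (S - s z))%R by rewrite mulr_ge0// subr_ge0 ltW.
  have das : (0 <= d a * (s z - s a))%R by rewrite mulr_ge0// subr_ge0.
  have FaE : F a = (g a - c + d a * (S - s z) + d a * (s z - s a))%R.
    by rewrite /tangent_height; ring.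
  apply/andP; split.
    apply: (@le_trans _ _ (\int[lebesgue_measure]_(p in `]F a, F z]) (phi (q p) z)%:E)).
      by rewrite gap lee_fin; lra.
    by apply: ge0_subset_integral => //; exact: heights_itv.
  have -> : J = \int[lebesgue_measure]_(p in `]F a, F z]) (phi (q p) z)%:E +
      \int[lebesgue_measure]_(p in E `\` `]F a, F z]) (phi (q p) z)%:E.
    rewrite -ge0_integral_setU//.
    - by rewrite setDUK//; exact: heights_itv.
    - exact: measurableD.
    - by rewrite setDUK//; exact: heights_itv.
    - by rewrite disj_set2E setDIK.
  rewrite gap.
  suff : \int[lebesgue_measure]_(p in E `\` `]F a, F z]) (phi (q p) z)%:E <= (F a)%:E.
    move=> h; apply: (le_trans (leeD2l _ h)).
    by rewrite -EFinD lee_fin; lra.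
  have -> : (F a)%:E = \int[lebesgue_measure]_(p in E `\` `]F a, F z])
      (\1_(`]0%R, F a]) p)%:E.
    rewrite integral_indic//; last exact: measurableD.
    have -> : `]0%R, F a] `&` (E `\` `]F a, F z]) = `]0%R, F a]%classic.
      apply/setIidPl => p; rewrite /= in_itv/= => /andP[p0 pa]; split.
        by split=> //; exists a.
      by rewrite in_itv/= ltNge pa.
    by rewrite -[RHS]/(lebesgue_measure _) lebesgue_measure_oc// subr0.
  apply: ge0_le_integral => //.
  - exact: measurableD.
  - by apply: measurable_funS mphi => // p [].
  - by apply/measurable_EFinP; exact: measurable_indic.
  move=> p [Ep]; rewrite /= in_itv/= => /negP; rewrite negb_and -leNgt -ltNge.
  have Dq := tangent_point_dom Ep.
  move=> /orP[pa|zp]; last first.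
    by rewrite escape_prob_eq0 ?lee_fin ?indicE//; exact: tangent_point_ge.
  rewrite lee_fin indicE mem_set ?escape_prob_le1//= in_itv/= pa andbT.
  by case: Ep.
have JE : J = (g z - c)%:E.
  apply/le_anti/andP; split; apply/lee_addgt0Pr => e /bracket /andP[h1 h2].
    by rewrite -EFinD.
  by rewrite -leeBlDr// -EFinB.
by rewrite JE -EFinD addrC subrK.
Qed.

(** The tangent at y meets the line at S no higher than the supremum of g,
because a chord from y to a point close to the right boundary is steeper. *)
Lemma heights_measure : ereal_sup [set (g z)%:E | z in D] = c%:E + lebesgue_measure E.
Proof.
have mE := measurable_heights.
apply/le_anti/andP; split.
  apply: ge_ereal_sup => _ [z Dz <-]; rewrite convex_representation//.
  rewrite leeD2l// -[leRHS]mul1e -integral_cst//; apply: ge0_le_integral => //.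
  - by move=> p _; rewrite lee_fin escape_prob_ge0.
  - by apply/measurable_EFinP; exact: escape_prob_tangent_measurable.
  - by move=> p /tangent_point_dom Dq; rewrite lee_fin escape_prob_le1.
have [z0 Dz0 _] := s_sup ltr01.
set G := ereal_sup _.
have gG z : D z -> (g z)%:E <= G by move=> Dz; apply: ereal_sup_ubound; exists z.
case: G gG => [G| |] gG; [|by rewrite leey|by have := gG _ Dz0].
have cG : (c <= G)%R by rewrite (le_trans (g_ge Dz0))// -lee_fin gG.
have FG y : D y -> (F y <= G - c)%R.
  move=> Dy; rewrite /tangent_height.
  suff : (g y + (S - s y) * d y <= G)%R by lra.
  apply/ler_addgt0Pr => e e0.
  have d0 := right_slope_ge0 Dy; have Sy := s_lt Dy.
  have d1 : (0 < d y + 1)%R by lra.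
  have h : (0 < Num.min (e / (d y + 1)) (S - s y))%R.
    by rewrite lt_min subr_gt0 Sy andbT divr_gt0.
  have [z Dz] := s_sup h; rewrite ltrBlDr -ltrBlDl lt_min => /andP[].
  rewrite ltr_pdivlMr// => hz yz.
  have yltz : (y < z)%R by apply: s_lt_inv => //; lra.
  have /andP[inc _] := increment_bounds Dy Dz (ltW yltz).
  have := gG _ Dz; rewrite lee_fin => gz.
  have Sz := s_lt Dz; nra.
rewrite -leeBrDl//.
have sub : E `<=` `]0%R, (G - c)%R]%classic.
  by move=> p [p0 [y Dy py]]; rewrite /= in_itv/= p0 (le_trans py)// FG.
rewrite -EFinB -[X in _ <= X%:E]subr0; apply: lebesgue_measure_sub_oc => //.
by rewrite subr_ge0.
Qed.

Lemma convex_superposition : superposition D phi g c E q.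
Proof.
split; first exact: measurable_heights.
- exact: tangent_point_measurable.
- exact: tangent_point_dom.
- move=> a b Da Db; have [b' Db' bb'] := dom_above Db.
  have sub : E `&` [set p | (a <= q p <= b)%R] `<=` `]0%R, F b']%classic.
    move=> p [Ep /= /andP[_ qb]]; rewrite in_itv/= (proj1 Ep) leNgt.
    apply/negP => /(tangent_point_ge Ep Db'); rewrite leNgt.
    by rewrite (le_lt_trans qb).
  have mq : measurable (E `&` [set p | (a <= q p <= b)%R]).
    rewrite (_ : [set p | _] = q @^-1` `[a, b]%classic).
      by apply: tangent_point_measurable => //; exact: measurable_heights.
    by apply/seteqP; split => p /=; rewrite in_itv.
  apply: (le_lt_trans (lebesgue_measure_sub_oc _ _ sub)); rewrite ?ltry//.
  exact: tangent_height_ge0.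
- by split; [exact: convex_representation|exact: heights_measure].
Qed.

End ConvexRepresentation.

Section Reflection.
Variables (R : realType) (l r : \bar R) (s g : R -> R) (S c : R).
Local Notation D := (dom l r).

Lemma dom_opp u : dom (- r) (- l) u <-> D (- u)%R.
Proof.
rewrite /dom /= EFinN; split => /andP[h1 h2]; apply/andP.
  by rewrite lteNr h2 lteNl.
by rewrite lteNl h2 lteNr.
Qed.

(** The mirror image under u |-> - u, which exchanges the two boundaries and
turns s into the scale - s (- u). *)
Lemma convex_superposition_nonincreasing :
  (forall u v, D u -> D v -> (u < v)%R -> (s u < s v)%R) ->
  (forall a b v, D a -> D b -> (a <= b)%R -> (s a <= v <= s b)%R ->
    exists2 y, (a <= y <= b)%R & s y = v) ->
  (forall u, D u -> (S < s u)%R) ->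
  (forall e : R, (0 < e)%R -> exists2 u, D u & (s u < S + e)%R) ->
  (forall M : R, exists2 u, D u & (M < s u)%R) ->
  (forall u v, D u -> D v -> (u <= v)%R -> (g v <= g u)%R) ->
  (forall a x b, D a -> D x -> D b -> (a < x < b)%R ->
    (g x * (s b - s a) <= g a * (s b - s x) + g b * (s x - s a))%R) ->
  (forall u, D u -> (c <= g u)%R) ->
  (forall e : R, (0 < e)%R -> exists2 u, D u & (g u < c + e)%R) ->
  exists E q, superposition D (escape_prob s S) g c E q.
Proof.
move=> s_incr s_ivt s_gt s_inf s_unb g_noninc g_conv g_ge g_inf.
pose s' u := (- s (- u))%R; pose g' u := g (- u)%R.
have DN u : D u -> dom (- r) (- l) (- u)%R by move=> Du; apply/dom_opp; rewrite opprK.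
have [] := @convex_superposition R (- r) (- l) s' g' (- S)%R c.
- by move=> u v /dom_opp Du /dom_opp Dv uv; rewrite ltrN2 s_incr// ltrN2.
- move=> a b v /dom_opp Da /dom_opp Db ab /andP[av vb].
  have [||y /andP[by_ ya] sy] := s_ivt (- b)%R (- a)%R (- v)%R Db Da.
  + by rewrite lerN2.
  + by rewrite lerNr vb lerNl.
  + exists (- y)%R; last by rewrite /s' opprK sy opprK.
    by rewrite lerNr ya lerNl.
- by move=> u /dom_opp Du; rewrite ltrN2 s_gt.
- move=> e e0; have [u Du su] := s_inf e e0.
  by exists (- u)%R; [exact: DN|rewrite /s' opprK; lra].
- move=> M; have [u Du su] := s_unb (- M)%R.
  by exists (- u)%R; [exact: DN|rewrite /s' opprK; lra].
- by move=> u v /dom_opp Du /dom_opp Dv uv; rewrite g_noninc// lerN2.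
- move=> a x b /dom_opp Da /dom_opp Dx /dom_opp Db /andP[ax xb].
  have bxa : (- b < - x < - a)%R by rewrite !ltrN2 xb.
  by have := g_conv _ _ _ Db Dx Da bxa; rewrite /s' /g'; lra.
- by move=> u /dom_opp Du; exact: g_ge.
- move=> e e0; have [u Du gu] := g_inf e e0.
  by exists (- u)%R; [exact: DN|rewrite /g' opprK].
set E := heights _ _ _ _ _ _; set q := tangent_point _ _ _ _ _ _.
move=> mE mq qD fin_E [rep total]; exists E, (fun p => - q p)%R; split => //.
- rewrite (_ : (fun p => - q p)%R = -%R \o q)//.
  by apply: measurableT_comp => //; exact: oppr_measurable.
- by move=> p /qD /dom_opp.
- move=> a b Da Db; have := fin_E _ _ (DN _ Db) (DN _ Da).
  rewrite (_ : [set p | (a <= - q p <= b)%R] = [set p | (- b <= q p <= - a)%R])//.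
  by apply/seteqP; split => p /= /andP[h1 h2]; apply/andP; split; lra.
- split.
    move=> z Dz; have := rep _ (DN _ Dz); rewrite /g' opprK => ->.
    congr (_ + _); apply: eq_integral => p _; congr EFin; rewrite /escape_prob /s' opprK.
    by congr (Num.max _ _); rewrite -[LHS]mulrNN -invrN; congr (_ / _)%R; ring.
  rewrite -total; congr ereal_sup; apply/seteqP; split => _ [z Dz <-].
    by exists (- z)%R; [exact: DN|rewrite /g' opprK].
  by exists (- z)%R => //; exact/dom_opp.
Qed.

End Reflection.

(** * Compactness in the extended line *)

Section ExtendedLine.
Variable R : realType.
Implicit Types (l r : \bar R) (K : set (\bar R)).

(** The order isomorphism of the extended line onto [-1, 1] transfers the
extreme value theorem for real functions to compact sets of extended reals. *)
Lemma contract_continuous : continuous (@contract R : \bar R -> R).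
Proof.
move=> z; apply/cvgrPdist_lt => e e0.
suff : nbhs z [set y | ball z e y] by [].
exact: nbhsx_ballx.
Qed.

Lemma dom_fine l r (z : \bar R) : l < z < r -> dom l r (fine z) /\ z = (fine z)%:E.
Proof.
move=> /andP[lz zr]; have zE : (fine z)%:E = z.
  by rewrite fineK// fin_numE gt_eqF ?(le_lt_trans _ lz) ?leNye// lt_eqF// (lt_le_trans zr)// leey.
by rewrite /dom/= zE lz zr.
Qed.

Lemma compact_in_dom l r K : K !=set0 -> compact K -> K `<=` [set z | l < z < r] ->
  exists a b, [/\ dom l r a, dom l r b & forall z, K z -> a%:E <= z <= b%:E].
Proof.
move=> K0 cK KD.
have cc : {within K, continuous (@contract R)}.
  by apply: continuous_subspaceT; exact: contract_continuous.
have [b + bmax] := compact_EVT_max K0 cK cc; rewrite inE => Kb.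
have [a + amin] := compact_EVT_min K0 cK cc; rewrite inE => Ka.
have [Da aE] := dom_fine (KD _ Ka); have [Db bE] := dom_fine (KD _ Kb).
exists (fine a), (fine b); split => // z Kz; rewrite -aE -bE.
apply/andP; split; rewrite -(@le_contract R).
  by apply: amin; rewrite inE.
by apply: bmax; rewrite inE.
Qed.

End ExtendedLine.

(** * Paths of a diffusion *)

Section Paths.
Variables (R : realType) (d : measure_display) (Omega : measurableType d).
Variables (l r : \bar R) (X : R -> Omega -> \bar R).
Variables (theta : R -> Omega -> Omega) (P : R -> probability Omega R).
Hypothesis hX : regular_diffusion l r X theta P.
Implicit Types (t u v a b y : R) (w : Omega).
Local Notation D := (dom l r).

Lemma path_nbhs w t (U : set (\bar R)) : (0 <= t)%R -> nbhs (X t w) U ->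
  exists2 e : R, (0 < e)%R & forall u, (0 <= u)%R -> (`|t - u| < e)%R -> U (X u w).
Proof.
move=> t0 nU; have /subspace_continuousP/(_ t t0 U nU) := @Defs.diff_continuous _ _ _ _ _ _ _ _ hX w.
rewrite /= /within/= => /nbhs_ballP[e /= e0 he]; exists e => // u u0 tu.
exact: he.
Qed.

Lemma path_open w t (U : set (\bar R)) : (0 <= t)%R -> open U -> U (X t w) ->
  exists2 e : R, (0 < e)%R & forall u, (0 <= u)%R -> (`|t - u| < e)%R -> U (X u w).
Proof. by move=> t0 oU Ut; apply: path_nbhs => //; exact: open_nbhs_nbhs. Qed.

Lemma open_interval (z z' : \bar R) : open [set x | z < x < z'].
Proof.
have -> : [set x | z < x < z'] = [set x | z < x] `&` [set x | x < z'].
  by apply/seteqP; split=> x /=; [move/andP|case=> -> ->].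
by apply: openI; [exact: open_ereal_gt_ereal|exact: open_ereal_lt_ereal].
Qed.

Lemma interior_before u t w : (0 <= u <= t)%R -> l < X t w < r -> l < X u w < r.
Proof.
move=> /andP[u0 ut] Xt; have /andP[lX Xr] := diff_range hX w u0.
have abs := @diff_absorbing _ _ _ _ _ _ _ _ hX u t w; rewrite u0 ut in abs.
apply/andP; split; rewrite lt_neqAle ?lX ?Xr andbT; apply/eqP => h.
  by move: Xt; rewrite abs ?h ?ltxx//; left.
by move: Xt; rewrite abs ?h ?ltxx ?andbF//; right.
Qed.

Lemma boundary_or_interior t w : (0 <= t)%R ->
  (X t w = l \/ X t w = r) \/ l < X t w < r.
Proof.
move=> t0; have /andP[lX Xr] := diff_range hX w t0.
have [->|Xl] := eqVneq (X t w) l; first by left; left.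
have [->|Xr'] := eqVneq (X t w) r; first by left; right.
by right; rewrite !lt_neqAle eq_sym Xl lX Xr' Xr.
Qed.

(** An interior path stays interior for a while by continuity, and an absorbed
one never leaves the boundary, so that survival can be read off from X t. *)
Lemma before_lifetimeP t w : (0 <= t)%R -> (t%:E < lifetime l r X w) = (l < X t w < r).
Proof.
move=> t0; apply/idP/idP => [tz|Xt].
  have [bd|//] := boundary_or_interior w t0.
  suff : lifetime l r X w <= t%:E by rewrite leNgt tz.
  apply/lee_addgt0Pr => e e0; apply: ge_ereal_inf; exists (t + e)%:E => //.
  exists (t + e)%R => //; split; first by rewrite ltr_wpDl.
  by rewrite (diff_absorbing hX _ bd) ?t0 ?lerDl ?ltW.
have [e e0 he] := path_open t0 (@open_interval l r) Xt.
apply: (@lt_le_trans _ _ (t + e)%:E); first by rewrite lte_fin ltrDl.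
apply: le_ereal_inf_tmp => _ [u [u0 bd] <-]; rewrite lee_fin leNgt; apply/negP => ute.
suff /andP[] : l < X u w < r by case: bd => ->; rewrite ltxx.
have [ut|tu] := leP u t; first by apply: (interior_before _ Xt); rewrite (ltW u0).
apply: he; first exact: ltW.
by rewrite ltr0_norm ?subr_lt0// opprB ltrBlDl.
Qed.

Lemma last_passage_le y t w : D y -> (0 <= t)%R ->
  last_passage l r X y w <= t%:E <-> forall u, (t < u)%R -> X u w <> y%:E.
Proof.
move=> Dy t0; split => [le u tu Xu|no].
  have u0 : (0 < u)%R by exact: le_lt_trans tu.
  move: tu; apply/negP; rewrite -leNgt -lee_fin (le_trans _ le)//.
  apply: ereal_sup_ubound; right; exists u => //; split => //.
  by rewrite before_lifetimeP ?ltW// Xu.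
apply: ge_ereal_sup => z [->|[u [u0 _ Xu] <-]]; first by rewrite lee_fin.
by rewrite lee_fin leNgt; apply/negP => /no.
Qed.
Lemma path_segment_compact w a b : (0 <= a)%R -> compact ((fun u => X u w) @` `[a, b]).
Proof.
move=> a0; apply: continuous_compact; last exact: segment_compact.
apply: continuous_subspaceW (@Defs.diff_continuous _ _ _ _ _ _ _ _ hX w) => u.
by rewrite /= in_itv/= => /andP[au _]; exact: le_trans au.
Qed.

Lemma path_in_compact t w : (0 <= t)%R -> l < X t w < r ->
  exists a b, [/\ D a, D b & forall u, (0 <= u <= t)%R -> a%:E <= X u w <= b%:E].
Proof.
move=> t0 Xt.
have [|||a [b [Da Db ab]]] := @compact_in_dom _ l r ((fun u => X u w) @` `[0%R, t]).
- by exists (X t w), t => //; rewrite /= in_itv/= t0 lexx.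
- exact: path_segment_compact.
- by move=> _ [u ut <-]; apply: interior_before Xt; move: ut; rewrite /= in_itv.
- by exists a, b; split=> // u ut; apply: ab; exists u => //; rewrite /= in_itv.
Qed.

Definition hits y : set Omega := [set w | exists2 u, (0 <= u)%R & X u w = y%:E].

Definition hits_after y t : set Omega :=
  [set w | exists2 u, (t < u)%R & X u w = y%:E].

Definition hits_within y a b : set Omega :=
  [set w | exists2 u, (a <= u <= b)%R & X u w = y%:E].

(** Equivalent to a comparison of hitting times by [hitting_time_lt], but free of
infima, and a countable combination of events [hits_within]. *)
Definition hits_before y a : set Omega := [set w | exists u,
  [/\ (0 <= u)%R, X u w = y%:E & forall v, (0 <= v <= u)%R -> X v w <> a%:E]].

Lemma hitting_time_finite y : [set w | hitting_time X y w < +oo] = hits y.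
Proof.
apply/seteqP; split => [w /ereal_inf_lt[_ [u [u0 Xu] _] _]|w [u u0 Xu]].
  by exists u.
rewrite /= (@le_lt_trans _ _ u%:E) ?ltry//.
by apply: ereal_inf_lbound; exists u.
Qed.

Lemma hitting_time_lt y a : y <> a ->
  [set w | hitting_time X y w < hitting_time X a w] = hits_before y a.
Proof.
move=> ya; apply/seteqP; split => w.
  move=> /ereal_inf_lt[_ [u [u0 Xu] <-]] ua; exists u; split => // v /andP[v0 vu] Xv.
  move: ua; apply/negP; rewrite -leNgt (@le_trans _ _ v%:E)//.
  by apply: ereal_inf_lbound; exists v.
move=> [u [u0 Xu na]].
have [e e0 he] : exists2 e : R, (0 < e)%R & forall v, (0 <= v)%R ->
    (`|u - v| < e)%R -> X v w <> a%:E.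
  have [//||e e0 he] := @path_open w u (~` [set a%:E]) u0.
  - exact/closed_openC/(accessible_closed_set1 (hausdorff_accessible (@ereal_hausdorff R))).
  - by rewrite /= Xu => -[].
  - by exists e.
apply: (@lt_le_trans _ _ (u + e)%:E).
  rewrite (@le_lt_trans _ _ u%:E) ?lte_fin ?ltrDl//.
  by apply: ereal_inf_lbound; exists u.
apply: le_ereal_inf_tmp => _ [v [v0 Xv] <-]; rewrite lee_fin leNgt; apply/negP => vue.
have [vu|uv] := leP v u; first by apply: (na v) Xv; rewrite v0.
by apply: (he v) Xv => //; rewrite ltr0_norm ?subr_lt0// opprB ltrBlDl.
Qed.

(** A continuous path visits y during a compact interval of times as soon as it
comes arbitrarily close to y at rational proportions of it, since the image of
the interval is closed. This is what makes hitting events measurable. *)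
Lemma hits_within_rat y a b w : (0 <= a <= b)%R -> hits_within y a b w <->
  forall n : nat, exists q : rat, (0 <= q <= 1)%R /\
    (y - n.+1%:R^-1)%:E < X (a + (b - a) * ratr q)%R w < (y + n.+1%:R^-1)%:E.
Proof.
move=> /andP[a0 ab]; split => [[u /andP[au ub] Xu] n|rat_near].
  have [] := @path_open w u _ (le_trans a0 au)
    (@open_interval (y - n.+1%:R^-1)%:E (y + n.+1%:R^-1)%:E).
    by rewrite /= Xu !lte_fin gtrBl ltrDl !invr_gt0 ltr0n.
  move=> e e0 he; have [ba|altb] := leP b a.
    have ab' : a = b by apply/le_anti; rewrite ab ba.
    have ua : u = a by apply/le_anti; rewrite au (le_trans ub).
    exists 0%R; rewrite lexx ler01 ab' subrr mul0r addr0; split=> //.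
    by apply: he; [rewrite -ab'|rewrite ua ab' subrr normr0].
  have ba0 : (0 < b - a)%R by rewrite subr_gt0.
  pose h := ((u - a) / (b - a))%R; pose k := (e / (b - a))%R.
  have k0 : (0 < k)%R by rewrite divr_gt0.
  have hk : (Num.max 0 (h - k) < Num.min 1 (h + k))%R.
    have h0 : (0 <= h)%R by rewrite divr_ge0 ?subr_ge0// ltW.
    have h1 : (h <= 1)%R by rewrite ler_pdivrMr// mul1r lerD2r.
    by rewrite gt_max !lt_min; apply/andP; split; apply/andP; split; lra.
  have [q] := rat_in_itvoo hk; rewrite in_itv/= gt_max lt_min.
  move=> /andP[/andP[q0 hq] /andP[q1 qh]].
  exists q; split.
    by rewrite -(ler0q R) -(ler_rat R) rmorph1 !ltW.
  have uE : (u = a + (b - a) * h)%R by rewrite /h mulrC divfK ?gt_eqF//; ring.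
  have eE : (e = (b - a) * k)%R by rewrite /k mulrC divfK ?gt_eqF.
  apply: he; first by rewrite addr_ge0// mulr_ge0// ltW.
  rewrite {1}uE eE opprD addrACA subrr add0r -mulrBr normrM gtr0_norm//.
  rewrite ltr_pM2l// ltr_norml; apply/andP; split; lra.
apply: contrapT => nhit.
have Kc := compact_closed (@ereal_hausdorff R) (@path_segment_compact w a b a0).
have nK : (~` ((fun u => X u w) @` `[a, b])) y%:E.
  by move=> [u ub Xu]; apply: nhit; exists u => //; move: ub; rewrite /= in_itv.
have : nbhs y%:E (~` ((fun u => X u w) @` `[a, b])).
  by apply: open_nbhs_nbhs; split => //; exact: closed_openC.
move=> /nbhs_EFin/nbhs_ballP[e /= e0 he].
have [n ne] : exists n : nat, (n.+1%:R^-1 < e)%R.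
  have := archi_boundP (x := e^-1); rewrite invr_ge0 ltW// => /(_ isT) h.
  exists (Num.bound e^-1); rewrite invf_plt ?posrE ?ltr0n//.
  by rewrite (lt_trans h)// ltr_nat.
have [q [/andP[q0 q1]]] := rat_near n; set v := (a + _)%R => Xv.
have [_ XvE] := dom_fine Xv; move: Xv; rewrite XvE !lte_fin => /andP[h1 h2].
apply: (he (fine (X v w))).
  move: (n.+1%:R^-1)%R ne h1 h2 => k ke h1 h2.
  by rewrite /ball /= ltr_norml; apply/andP; split; lra.
exists v => //; rewrite /= in_itv/=.
have q0' : (0 <= ratr q :> R)%R by rewrite ler0q.
have q1' : (ratr q <= 1 :> R)%R by rewrite -(rmorph1 (@ratr R)) ler_rat.
by rewrite /v; apply/andP; split; nra.
Qed.

Lemma hits_beforeE y a : y <> a -> hits_before y a =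
  \bigcup_(q : rat) (if (0 <= q)%R then
    hits_within y 0 (ratr q) `\` hits_within a 0 (ratr q) else set0).
Proof.
move=> ya; apply/seteqP; split => [w [u [u0 Xu na]]|w [q _]].
  have [//||e e0 he] := @path_open w u (~` [set a%:E]) u0.
  - exact/closed_openC/(accessible_closed_set1 (hausdorff_accessible (@ereal_hausdorff R))).
  - by rewrite /= Xu => -[].
  have ue : (u < u + e)%R by rewrite ltrDl.
  have [q] := rat_in_itvoo ue; rewrite in_itv/= => /andP[uq qe].
  exists q => //; have -> : (0 <= q)%R.
    by rewrite -(ler0q R) (le_trans u0)// ltW.
  split; first by exists u => //; rewrite u0 ltW.
  move=> [v /andP[v0 vq] Xv]; have [vu|uv] := leP v u.
    by apply: (na v) Xv; rewrite v0.
  by apply: (he v) Xv => //; rewrite ltr0_norm ?subr_lt0//; lra.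
case: ifPn => // q0 [[u /andP[u0 uq] Xu] na]; exists u; split => // v /andP[v0 vu] Xv.
by apply: na; exists v => //; rewrite v0 (le_trans vu).
Qed.

Lemma hitsE y : hits y = \bigcup_n hits_within y 0 n%:R.
Proof.
apply/seteqP; split => [w [u u0 Xu]|w [n _ [u /andP[u0 _] Xu]]]; last by exists u.
exists (Num.bound u) => //; exists u => //.
by rewrite u0 ltW// archi_boundP.
Qed.

Lemma hits_afterE y t : hits_after y t =
  \bigcup_k \bigcup_n hits_within y (t + k.+1%:R^-1) (t + k.+1%:R^-1 + n%:R).
Proof.
apply/seteqP; split => [w [u tu Xu]|w [k _ [n _ [u /andP[tu _] Xu]]]]; last first.
  by exists u => //; rewrite (lt_le_trans _ tu)// ltrDl invr_gt0.
have ut0 : (0 < u - t)%R by rewrite subr_gt0.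
pose k := Num.bound (u - t)^-1; pose v := (t + k.+1%:R^-1)%R.
have vu : (v <= u)%R.
  rewrite /v -lerBrDl invf_ple ?posrE//.
  by rewrite (le_trans (ltW (archi_boundP _)))// ?invr_ge0 ?ltW// ltr_nat.
exists k => //; exists (Num.bound (u - v)) => //; exists u => //.
by rewrite vu -lerBlDl ltW// archi_boundP// subr_ge0.
Qed.

(** At the exit time the path, being continuous, sits at the endpoint of the
interval which it reaches first. *)
Lemma exit_trichotomy x a b t w : (a < x < b)%R -> X 0%R w = x%:E -> (0 <= t)%R ->
  let T := fine (mine t%:E (exit_time X a b w)) in
  [\/ [/\ hits_before a b w, hits_within a 0 t w & X T w = a%:E],
    [/\ hits_before b a w, hits_within b 0 t w & X T w = b%:E] |
    [/\ ~ hits_within a 0 t w, ~ hits_within b 0 t w, T = t &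
      a%:E < X t w < b%:E]].
Proof.
move=> /andP[ax xb] X0 t0 T.
have exit_ge0 : 0 <= exit_time X a b w.
  by apply: le_ereal_inf_tmp => _ [u [u0 _] <-]; rewrite lee_fin.
have inside u : (0 <= u)%R -> u%:E < exit_time X a b w -> a%:E < X u w < b%:E.
  move=> u0 uT; apply: contrapT => nin; move: uT; apply/negP; rewrite -leNgt.
  by apply: ereal_inf_lbound; exists u.
have [tT|Tt] := ltP t%:E (exit_time X a b w).
  have inside_t u : (0 <= u <= t)%R -> a%:E < X u w < b%:E.
    by move=> /andP[u0 ut]; apply: inside => //; rewrite (le_lt_trans _ tT)// lee_fin.
  have -> : T = t by rewrite /T min_l// ltW.
  constructor 3; split=> //; last by apply: inside_t; rewrite t0 lexx.
    by move=> [u /inside_t + Xu]; rewrite Xu ltxx.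
  by move=> [u /inside_t + Xu]; rewrite Xu ltxx andbF.
have TE : exit_time X a b w = T%:E.
  rewrite /T min_r// fineK// fin_numE gt_eqF ?(lt_le_trans _ exit_ge0)//.
  by rewrite lt_eqF// (le_lt_trans Tt) ?ltry.
have T0 : (0 <= T)%R by rewrite -lee_fin -TE.
have XT_out : ~ (a%:E < X T w < b%:E).
  move=> XT; have [e e0 he] := path_open T0 (@open_interval a%:E b%:E) XT.
  suff : (T + e)%:E <= exit_time X a b w by rewrite TE lee_fin gerDl leNgt e0.
  apply: le_ereal_inf_tmp => _ [u [u0 out] <-]; rewrite lee_fin leNgt; apply/negP => uTe.
  apply: out; have [uT|Tu] := ltP u T; first by apply: inside => //; rewrite TE lte_fin.
  by apply: he => //; rewrite ler0_norm ?subr_le0//; lra.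
have Tpos : (0 < T)%R.
  rewrite lt_neqAle T0 andbT; apply/eqP => T0'; apply: XT_out.
  by rewrite -T0' X0 !lte_fin ax xb.
(* otherwise the path would already be outside (a, b) just before T *)
have not_outside (U : set (\bar R)) : open U ->
    (forall z, U z -> ~ (a%:E < z < b%:E)) -> ~ U (X T w).
  move=> oU Uout UT; have [e e0 he] := path_open T0 oU UT.
  pose u := Num.max 0%R (T - e / 2)%R.
  have u0 : (0 <= u)%R by rewrite le_max lexx.
  have uT : (u < T)%R by rewrite gt_max Tpos/=; lra.
  have Tue : (T - e / 2 <= u)%R by rewrite le_max lexx orbT.
  apply: (Uout (X u w)); last by apply: inside => //; rewrite TE lte_fin.
  by apply: he => //; rewrite gtr0_norm ?subr_gt0//; lra.
have aXT : a%:E <= X T w.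
  rewrite leNgt; apply/negP; apply: (not_outside [set z | z < a%:E]).
    exact: open_ereal_lt_ereal.
  by move=> z /= za /andP[az _]; move: (lt_trans za az); rewrite ltxx.
have XTb : X T w <= b%:E.
  rewrite leNgt; apply/negP; apply: (not_outside [set z | b%:E < z]).
    exact: open_ereal_gt_ereal.
  by move=> z /= bz /andP[_ zb]; move: (lt_trans bz zb); rewrite ltxx.
have first y y' : X T w = y%:E -> y <> y' -> ~ (a < y' < b)%R -> hits_before y y' w.
  move=> XT yy' nin; exists T; split => // v /andP[v0 vT] Xv.
  have [vltT|Tv] := ltP v T.
    by apply: nin; rewrite -!lte_fin -Xv inside// TE lte_fin.
  have vE : v = T by apply/le_anti; rewrite vT.
  by apply: yy'; apply: EFin_inj; rewrite -XT -Xv vE.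
have Tlet : (0 <= T <= t)%R by rewrite T0 -lee_fin -TE.
have [XTa|XTa] := eqVneq (X T w) a%:E.
  constructor 1; split=> //; last (by exists T); apply: first => //; last by rewrite ltxx andbF.
  by move=> ab; move: (lt_trans ax xb); rewrite ab ltxx.
have [XTb'|XTb'] := eqVneq (X T w) b%:E.
  constructor 2; split=> //; last (by exists T); apply: first => //; last by rewrite ltxx.
  by move=> ab; move: (lt_trans ax xb); rewrite ab ltxx.
by exfalso; apply: XT_out; rewrite !lt_neqAle eq_sym XTa aXT XTb' XTb.
Qed.

End Paths.

(** * The filtration and the Markov property *)

Section Markov.
Variables (R : realType) (d : measure_display) (Omega : measurableType d).
Variables (l r : \bar R) (X : R -> Omega -> \bar R).
Variables (theta : R -> Omega -> Omega) (P : R -> probability Omega R).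
Hypothesis hX : regular_diffusion l r X theta P.
Implicit Types (t u v a b x y z : R) (w : Omega) (A B : set Omega).
Local Notation D := (dom l r).
Local Notation Fnat := (natural_filtration X).
Local Notation Snat := (natural_sigma_algebra X).
Local Notation F := (filtration l r X P).

Lemma natural_filtration_le t t' : (t <= t')%R -> Fnat t `<=` Fnat t'.
Proof.
move=> tt'; apply: sub_sigma_algebra2 => A [u [B [/andP[u0 ut] mB AE]]].
by exists u, B; split => //; rewrite u0 (le_trans ut).
Qed.

Lemma natural_filtration_sub t : Fnat t `<=` Snat.
Proof.
apply: sub_sigma_algebra2 => A [u [B [/andP[u0 _] mB AE]]].
by exists u, B.
Qed.

Lemma generated_setT (T : pointedType) (G : set (set T)) : <<s G >> setT.
Proof. exact: (@measurableT _ (g_sigma_algebraType G)). Qed.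

Lemma generated_bigcup (T : pointedType) (G : set (set T)) (f : nat -> set T) :
  (forall n, <<s G >> (f n)) -> <<s G >> (\bigcup_n f n).
Proof. exact: (@bigcupT_measurable _ (g_sigma_algebraType G)). Qed.

Lemma generated_bigcap (T : pointedType) (G : set (set T)) (f : nat -> set T) :
  (forall n, <<s G >> (f n)) -> <<s G >> (\bigcap_n f n).
Proof. exact: (@bigcapT_measurable _ (g_sigma_algebraType G)). Qed.

Lemma generated_bigcup_rat (T : pointedType) (G : set (set T)) (f : rat -> set T) :
  (forall q, <<s G >> (f q)) -> <<s G >> (\bigcup_q f q).
Proof. exact: (@bigcupT_measurable_rat _ (g_sigma_algebraType G)). Qed.

Lemma generated_setC (T : pointedType) (G : set (set T)) (A : set T) : <<s G >> A -> <<s G >> (~` A).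
Proof. exact: (@measurableC _ (g_sigma_algebraType G)). Qed.

Lemma generated_setD (T : pointedType) (G : set (set T)) (A B : set T) :
  <<s G >> A -> <<s G >> B -> <<s G >> (A `\` B).
Proof. exact: (@measurableD _ (g_sigma_algebraType G)). Qed.

Lemma generated_setI (T : pointedType) (G : set (set T)) (A B : set T) :
  <<s G >> A -> <<s G >> B -> <<s G >> (A `&` B).
Proof. exact: (@measurableI _ (g_sigma_algebraType G)). Qed.

Lemma generated_setU (T : pointedType) (G : set (set T)) (A B : set T) :
  <<s G >> A -> <<s G >> B -> <<s G >> (A `|` B).
Proof. exact: (@measurableU _ (g_sigma_algebraType G)). Qed.

Lemma natural_filtration_preimage t u (B : set (\bar R)) : (0 <= u <= t)%R ->
  measurable B -> Fnat t (X u @^-1` B).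
Proof. by move=> ut mB; apply: sub_sigma_algebra; exists u, B. Qed.

Lemma hits_within_natural_filtration y a b : (0 <= a <= b)%R ->
  Fnat b (hits_within X y a b).
Proof.
move=> ab; have -> : hits_within X y a b = \bigcap_n \bigcup_(q : rat)
    (if (0 <= q <= 1)%R then
      X (a + (b - a) * ratr q)%R @^-1` [set z | (y - n.+1%:R^-1)%:E < z < (y + n.+1%:R^-1)%:E]
     else set0).
  apply/seteqP; split => w.
    move=> /(hits_within_rat hX y w ab) h n _; have [q [q01 Xq]] := h n.
    by exists q => //; rewrite q01.
  move=> h; apply/(hits_within_rat hX y w ab) => n.
  have [q _] := h n I; case: ifP => // q01 Xq.
  by exists q.
apply: generated_bigcap => n; apply: generated_bigcup_rat => q.
case: ifP => [/andP[q0 q1]|_]; last exact: sigma_algebra0.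
apply: natural_filtration_preimage.
  have q0' : (0 <= ratr q :> R)%R by rewrite ler0q.
  have q1' : (ratr q <= 1 :> R)%R by rewrite -(rmorph1 (@ratr R)) ler_rat.
  by move: ab => /andP[a0 ab]; apply/andP; split; nra.
have -> : [set z : \bar R | (y - n.+1%:R^-1)%:E < z < (y + n.+1%:R^-1)%:E] =
   [set` `](y - n.+1%:R^-1)%:E, (y + n.+1%:R^-1)%:E[ ].
  by apply/seteqP; split => z; rewrite /= in_itv.
exact: emeasurable_itv.
Qed.

Lemma hits_within_natural y a b : (0 <= a <= b)%R -> Snat (hits_within X y a b).
Proof. by move=> /hits_within_natural_filtration/natural_filtration_sub. Qed.

Lemma hits_natural y : Snat (hits X y).
Proof.
rewrite (hitsE X); apply: generated_bigcup => n.
by apply: hits_within_natural; rewrite lexx ler0n.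
Qed.

Lemma hits_after_natural y t : (0 <= t)%R -> Snat (hits_after X y t).
Proof.
move=> t0; rewrite (hits_afterE X); apply: generated_bigcup => k.
apply: generated_bigcup => n; apply: hits_within_natural.
by rewrite addr_ge0//= lerDl.
Qed.

Lemma hits_before_natural y a : y <> a -> Snat (hits_before X y a).
Proof.
move=> ya; rewrite (hits_beforeE hX)//; apply: generated_bigcup_rat => q.
case: ifP => q0; last exact: sigma_algebra0.
by apply: generated_setD; apply: hits_within_natural; rewrite lexx ler0q.
Qed.

Lemma initial_law_set0 (nu : probability R R) : initial_law l r P nu set0 = 0.
Proof.
by rewrite /initial_law; apply: integral0_eq => z _; rewrite measure0.
Qed.

Lemma sub_universal_completion (G : set (set Omega)) : G `<=` universal_completion l r X P G.
Proof.
move=> A GA nu _; exists A, set0; split => //.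
- exact: sigma_algebra0.
- exact: initial_law_set0.
- by rewrite setDv setU0.
Qed.

Lemma natural_measurable A : Snat A -> measurable A.
Proof.
by move=> SA; apply/(diff_sigma_algebra hX); exact: sub_universal_completion.
Qed.

Lemma filtration_measurable t A : (0 <= t)%R -> F t A -> measurable A.
Proof.
move=> t0 /(_ (t + 1)%R); rewrite ltrDl => /(_ ltr01) FA.
apply/(diff_sigma_algebra hX) => nu nu1; have [B [N [GB ? ? ?]]] := FA nu nu1.
by exists B, N; split => //; exact: natural_filtration_sub GB.
Qed.

Lemma natural_filtration_filtration t : Fnat t `<=` F t.
Proof.
move=> A FA u tu; apply: sub_universal_completion.
by apply: natural_filtration_le FA; exact: ltW.
Qed.

Lemma filtration_le t t' : (t <= t')%R -> F t `<=` F t'.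
Proof. by move=> tt' A FA u t'u; apply: FA; exact: le_lt_trans t'u. Qed.

(** For the intersection of two completed events, whose exceptional set lies in
the union of theirs. *)
Lemma initial_law_setU (nu : probability R R) N N' : Snat N -> Snat N' ->
  initial_law l r P nu N = 0 -> initial_law l r P nu N' = 0 ->
  initial_law l r P nu (N `|` N') = 0.
Proof.
move=> SN SN' N0 N'0.
have mD : measurable (D : set R) by apply: is_interval_measurable; exact: dom_interval.
have mP B : Snat B -> measurable_fun D (fun z => P z B) by exact: diff_kernel hX _.
apply/eqP; rewrite eq_le; apply/andP; split; last first.
  by apply: integral_ge0 => z _.
rewrite -(adde0 0) -{1}N0 -{1}N'0 /initial_law -ge0_integralD//; [|exact: mP..].
apply: ge0_le_integral => //.
- by apply: mP; exact: generated_setU.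
- by apply: emeasurable_funD; exact: mP.
- by move=> z Dz; apply: measureU2; exact: natural_measurable.
Qed.

Lemma filtrationI t A B : F t A -> F t B -> F t (A `&` B).
Proof.
move=> FA FB u tu nu nu1.
have [A' [N [GA SN N0 AN]]] := FA u tu nu nu1.
have [B' [N' [GB SN' N'0 BN]]] := FB u tu nu nu1.
exists (A' `&` B'), (N `|` N'); split.
- exact: generated_setI.
- exact: generated_setU.
- exact: initial_law_setU.
move=> w; have := AN w; have := BN w; rewrite /setU /setD /setI /= => hB hA.
have [Aw|Aw] := pselect (A w); have [Bw|Bw] := pselect (B w);
have [Aw'|Aw'] := pselect (A' w); have [Bw'|Bw'] := pselect (B' w); tauto.
Qed.

Lemma filtrationT t : F t setT.
Proof. by apply: natural_filtration_filtration; exact: generated_setT. Qed.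

(** The strong Markov property is used at deterministic times only; by
[before_lifetimeP] the event of survival becomes X t being interior. *)
Lemma markov_property x t A B : D x -> (0 <= t)%R -> F t A -> Snat B ->
  P x (A `&` [set w | l < X t w < r] `&` [set w | B (theta t w)]) =
  \int[P x]_(w in A `&` [set w | l < X t w < r]) P (fine (X t w)) B.
Proof.
move=> Dx t0 FA SB.
have ltE : [set w | t%:E < lifetime l r X w] = [set w | l < X t w < r].
  by apply/seteqP; split => w /=; rewrite (before_lifetimeP hX).
have Tstop : stopping_time l r X P (fun=> t%:E).
  split=> [w|u u0]; first by rewrite lee_fin.
  case: (leP t%:E u%:E) => tu.
    by rewrite (_ : [set _ | _] = setT); [exact: filtrationT|apply/seteqP; split].
  rewrite (_ : [set _ | _] = set0); last by apply/seteqP; split.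
  by apply: natural_filtration_filtration; exact: sigma_algebra0.
have := diff_strong_markov hX Dx Tstop (A := A) _ SB; rewrite /= ltE; apply.
split; first exact: filtration_measurable FA.
move=> u u0; case: (leP t%:E u%:E) => tu.
  rewrite (_ : [set _ | _] = setT); last by apply/seteqP; split.
  by rewrite setIT; exact: filtration_le FA.
rewrite (_ : [set _ | _] = set0); last by apply/seteqP; split.
rewrite setI0; apply: natural_filtration_filtration.
exact: sigma_algebra0.
Qed.

End Markov.

(** * Hitting probabilities *)

Section Hitting.
Variables (R : realType) (d : measure_display) (Omega : measurableType d).
Variables (l r : \bar R) (X : R -> Omega -> \bar R).
Variables (theta : R -> Omega -> Omega) (P : R -> probability Omega R).
Variable s : R -> R.
Hypothesis hX : regular_diffusion l r X theta P.
Hypothesis hs : scale_function l r X P s.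
Implicit Types (t u v a b x y z : R) (w : Omega) (A B : set Omega).
Local Notation D := (dom l r).
Local Notation Fnat := (natural_filtration X).
Local Notation Snat := (natural_sigma_algebra X).
Local Notation F := (filtration l r X P).

Lemma dom_open u : D u -> exists a b, [/\ D a, D b & (a < u < b)%R].
Proof.
move=> /andP[lu ur]; have [e he] := lt_ereal_nbhs lu ur.
have e0 : (0 < e%:num / 2)%R by rewrite divr_gt0.
have ee : (e%:num / 2 < e%:num)%R by rewrite gtr_pMr// invf_lt1// ltr1n.
exists (u - e%:num / 2)%R, (u + e%:num / 2)%R; split.
- by apply: he; rewrite addrAC subrr add0r normrN gtr0_norm.
- by apply: he; rewrite addrAC subrr add0r gtr0_norm.
- by rewrite gtrBl ltrDl e0.
Qed.

Lemma scale_incr u v : D u -> D v -> (u < v)%R -> (s u < s v)%R.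
Proof. by move=> Du Dv; case: hs => h _ _; apply: h; rewrite inE. Qed.

Lemma scale_nondecr u v : D u -> D v -> (u <= v)%R -> (s u <= s v)%R.
Proof.
move=> Du Dv; rewrite le_eqVlt => /orP[/eqP -> //|uv].
by rewrite ltW// scale_incr.
Qed.

Lemma measurable_path t : (0 <= t)%R -> measurable_fun setT (X t).
Proof.
move=> t0 _ B mB; rewrite setTI; apply: (natural_measurable hX).
apply: (@natural_filtration_sub _ _ _ _ t).
by apply: natural_filtration_preimage; rewrite ?t0 ?lexx.
Qed.

Lemma shift_natural t B : (0 <= t)%R -> Snat B -> Snat [set w | B (theta t w)].
Proof.
move=> t0; apply: (@smallest_sub _ (sigma_algebra setT) _ [set B | Snat [set w | B (theta t w)]]).
  split=> /= [|B' SB|B' SB].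
  - exact: sigma_algebra0.
  - rewrite (_ : [set w | _] = ~` [set w | B' (theta t w)]); first exact: generated_setC SB.
    by apply/seteqP; split => w /=; tauto.
  - exact: generated_bigcup SB.
move=> _ [u [B' [u0 mB ->]]]; apply: sub_sigma_algebra; exists (t + u)%R, B'.
split=> //; first by rewrite addr_ge0.
by apply/seteqP; split => w /=; rewrite (diff_shift hX).
Qed.

Definition starts x : set Omega := [set w | X 0%R w = x%:E].

Lemma starts_natural x t : (0 <= t)%R -> Fnat t (starts x).
Proof.
move=> t0; rewrite (_ : starts x = X 0%R @^-1` [set x%:E]).
  by apply: natural_filtration_preimage => //; rewrite lexx.
by apply/seteqP; split.
Qed.

Lemma measurable_starts x : measurable (starts x).
Proof.
apply: (natural_measurable hX); apply: (@natural_filtration_sub _ _ _ _ 0%R).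
exact: starts_natural.
Qed.

(** Pathwise statements are only made for paths starting at the right point,
which carry all the mass. *)
Lemma prob_startsI x A : D x -> measurable A -> P x (A `&` starts x) = P x A.
Proof.
move=> Dx mA; have mS := measurable_starts x.
have SC0 : P x (~` starts x) = 0.
  by rewrite probability_setC// (diff_start hX Dx) subee.
have D0 : P x (A `\` starts x) = 0.
  apply/eqP; rewrite eq_le measure_ge0 andbT -SC0; apply: le_measure; rewrite ?inE.
  - exact: measurableD.
  - exact: measurableC.
  - by move=> w [].
have DI : P x A = P x (A `\` starts x) + P x (A `&` starts x) by exact: measureDI.
by rewrite DI D0 add0e.
Qed.

Lemma prob_le_start x A B : D x -> measurable A -> measurable B ->
  (forall w, X 0%R w = x%:E -> A w -> B w) -> P x A <= P x B.
Proof.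
move=> Dx mA mB AB; rewrite -prob_startsI//; apply: le_measure; rewrite ?inE//.
  by apply: measurableI => //; exact: measurable_starts.
by move=> w [Aw Sw]; exact: AB.
Qed.

Lemma prob_eq_start x A B : D x -> measurable A -> measurable B ->
  (forall w, X 0%R w = x%:E -> (A w <-> B w)) -> P x A = P x B.
Proof.
by move=> Dx mA mB AB; apply/le_anti; rewrite !prob_le_start//; move=> w /AB[].
Qed.

Lemma measurable_interior t : (0 <= t)%R -> measurable [set w | l < X t w < r].
Proof.
move=> t0; have -> : [set w | l < X t w < r] = setT `&` X t @^-1` [set` `]l, r[].
  by rewrite setTI; apply/seteqP; split => w; rewrite /= in_itv.
by apply: measurable_path => //; exact: emeasurable_itv.
Qed.

Lemma measurable_kernel_path t B A : (0 <= t)%R -> Snat B -> measurable A ->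
  A `<=` [set w | l < X t w < r] ->
  measurable_fun A (fun w => P (fine (X t w)) B).
Proof.
move=> t0 SB mA AD.
apply: (@measurable_comp _ _ _ _ _ _ D (fun z => P z B) A (fun w => fine (X t w))).
- by apply: is_interval_measurable; exact: dom_interval.
- by move=> _ [w /AD/dom_fine[Dw _] <-].
- exact: diff_kernel hX _ SB.
- apply: measurable_funS (measurableT) (@subsetT _ _) _.
  by apply: measurableT_comp => //; exact: measurable_path.
Qed.

Lemma hits_before_prob_up a x b : D a -> D b -> (a < x < b)%R ->
  P x (hits_before X b a) = ((s x - s a) / (s b - s a))%:E.
Proof.
move=> Da Db axb; case: hs => _ _ <- //; rewrite (hitting_time_lt hX)//.
by move: axb => /[swap] -> /andP[h1 h2]; move: (lt_trans h1 h2); rewrite ltxx.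
Qed.

Lemma interval_neq a x b : (a < x < b)%R -> a <> b /\ b <> a.
Proof. by move=> /andP[ax xb]; have ab := lt_trans ax xb; split=> h; move: ab; rewrite h ltxx. Qed.

Lemma hits_before_hits y a : hits_before X y a `<=` hits X y.
Proof. by move=> w [u [u0 Xu _]]; exists u. Qed.

Definition stays a b t : set Omega :=
  ~` (hits_within X a 0 t `|` hits_within X b 0 t).

Lemma stays_natural_filtration a b t : (0 <= t)%R -> Fnat t (stays a b t).
Proof.
move=> t0; apply: generated_setC; apply: generated_setU;
  by apply: (hits_within_natural_filtration hX); rewrite lexx.
Qed.

Lemma measurable_stays a b t : (0 <= t)%R -> measurable (stays a b t).
Proof.
move=> t0; apply: (natural_measurable hX).
exact: natural_filtration_sub (stays_natural_filtration a b t0).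
Qed.

Lemma stays_cvg x a b :
  P x (stays a b n%:R) @[n --> \oo] --> P x (~` (hits X a `|` hits X b)).
Proof.
have cap : \bigcap_n stays a b n%:R = ~` (hits X a `|` hits X b).
  apply/seteqP; split => [w Aw|w Nw n _].
    move=> h; case: h => -[u u0 Xu]; apply: (Aw (Num.bound u) I); [left|right];
      by exists u => //; rewrite u0 ltW// archi_boundP.
  by move=> h; apply: Nw; case: h => -[u /andP[u0 _] Xu]; [left|right]; exists u.
have m0 : measurable (stays a b 0) by exact: measurable_stays.
rewrite -cap; apply: (nonincreasing_cvg_mu (mu := P x)).
- by rewrite (le_lt_trans (probability_le1 _ m0)) ?ltry.
- by move=> n; exact: measurable_stays.
- by apply: bigcapT_measurable => n; exact: measurable_stays.
- move=> m n mn; apply/subsetPset => w Aw h; apply: Aw.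
  case: h => -[u /andP[u0 um] Xu]; [left|right]; exists u => //;
    by rewrite u0 (le_trans um)// ler_nat.
Qed.

(** From every point of (a, b) the diffusion has a chance of at least
epsilon > 0 to reach b. By the Markov property at time n, the probability of
staying in (a, b) forever is thus at most 1 - epsilon times the probability of
staying there up to time n, and the latter decreases to the former. *)
Lemma exit_interval a x b : D a -> D x -> D b -> (a < x < b)%R ->
  P x (~` (hits X a `|` hits X b)) = 0.
Proof.
move=> Da Dx Db axb; set N := ~` _.
have SN : Snat N.
  by apply: generated_setC; apply: generated_setU; exact: (hits_natural hX).
have mN := natural_measurable hX SN.
have [a' [_ [Da' _ /andP[a'a _]]]] := dom_open Da.
have ab : (a < b)%R by move: axb => /andP[]; exact: lt_trans.
have saa' := scale_incr Da' Da a'a; have sab := scale_incr Da Db ab.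
(* the probability of reaching b before a' from a, hence a lower bound for the
   probability of reaching b from any point of (a, b) *)
pose e := ((s a - s a') / (s b - s a'))%R.
have e0 : (0 < e)%R by rewrite divr_gt0; lra.
have uN z : (a < z < b)%R -> P z N <= (1 - e)%:E.
  move=> /andP[az zb]; have Dz : D z by apply: (dom_interval Da Db); rewrite (ltW az) ltW.
  have mH : measurable (hits X b) by apply: (natural_measurable hX); exact: (hits_natural hX).
  apply: (@le_trans _ _ (P z (~` hits X b))).
    apply: le_measure; rewrite ?inE//; first exact: measurableC.
    by apply: subsetC; exact: subsetUr.
  have a'zb : (a' < z < b)%R by rewrite zb (lt_trans a'a).
  rewrite probability_setC// EFinB leeB//.
  apply: (@le_trans _ _ (P z (hits_before X b a'))); last first.
    apply: le_measure; rewrite ?inE//; last exact: hits_before_hits.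
    apply: (natural_measurable hX); apply: (hits_before_natural hX).
    by case: (interval_neq a'zb).
  rewrite hits_before_prob_up// lee_fin /e ler_pM2r ?invr_gt0; last lra.
  by rewrite lerD2r scale_nondecr// ltW.
pose A n := stays a b n%:R.
have FA n : Fnat n%:R (A n) by exact: stays_natural_filtration.
have mA n : measurable (A n) by exact: measurable_stays.
have inside n w : X 0%R w = x%:E -> A n w -> a%:E < X n%:R w < b%:E.
  move=> X0 An; have [[_ h _]|[_ h _]|[]//] := exit_trichotomy hX axb X0 (ler0n R n).
    by exfalso; apply: An; left.
  by exfalso; apply: An; right.
have NA n : P x N <= (1 - e)%:E * P x (A n).
  pose A' := A n `&` starts x.
  have n0 : (0 <= n%:R :> R)%R := ler0n R n.
  have FA' : F n%:R A'.
    apply: natural_filtration_filtration; apply: generated_setI; [exact: FA|exact: starts_natural].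
  have mA' := filtration_measurable hX n0 FA'.
  have A'in : A' `<=` [set w | l < X n%:R w < r].
    move=> w [An X0]; have /andP[aX Xb] := inside n w X0 An.
    by move: Da Db => /andP[la _] /andP[_ br]; rewrite /= (lt_trans la aX) (lt_trans Xb br).
  have mark := markov_property hX Dx n0 FA' SN.
  rewrite (setIidl A'in) in mark.
  apply: (@le_trans _ _ (P x (A' `&` [set w | N (theta n%:R w)]))).
    have mNt : measurable (N `&` starts x) by apply: measurableI => //; exact: measurable_starts.
    rewrite -(prob_startsI Dx mN); apply: le_measure; rewrite ?inE//.
      apply: measurableI => //; apply: (natural_measurable hX).
      exact: shift_natural.
    move=> w [Nw X0]; split.
      split=> // -[] [u /andP[u0 _] Xu]; apply: Nw; [left|right]; by exists u.
    move=> h; apply: Nw; case: h => -[u u0]; rewrite (diff_shift hX)// => Xu; [left|right];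
      by exists (n%:R + u)%R => //; rewrite addr_ge0.
  rewrite mark; apply: (@le_trans _ _ (\int[P x]_(w in A') (1 - e)%:E)).
    apply: ge0_le_integral => //.
    - exact: measurable_kernel_path.
    - move=> w [An X0]; apply: uN.
      have := inside n w X0 An; have [_ ->] := dom_fine (A'in w (conj An X0)).
      by rewrite !lte_fin.
  by rewrite integral_cst// -(prob_startsI Dx (mA n)).
have cvgA : (P x \o A) n @[n --> \oo] --> P x N by exact: stays_cvg.
have : P x N <= (1 - e)%:E * P x N.
  have cvgeA : ((1 - e)%:E * P x (A n)) @[n --> \oo] --> (1 - e)%:E * P x N.
    exact: cvgeZl cvgA.
  rewrite -(cvg_lim (@ereal_hausdorff R) cvgeA); apply: lime_ge.
    by apply/cvg_ex; eexists; exact: cvgeA.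
  by apply: nearW => n; exact: NA.
rewrite -(fineK (fin_num_measure (P x) _ mN)) -EFinM lee_fin => h.
congr EFin; apply/le_anti; rewrite fine_ge0// andbT.
have := fine_ge0 (measure_ge0 (P x) N); nra.
Qed.

Lemma measurable_hits_before y a : y <> a -> measurable (hits_before X y a).
Proof. by move=> ya; apply: (natural_measurable hX); exact: (hits_before_natural hX). Qed.

Lemma measurable_hits y : measurable (hits X y).
Proof. by apply: (natural_measurable hX); exact: (hits_natural hX). Qed.

(** As the exit time of (a, b) is finite, exactly one of the endpoints is
visited first. *)
Lemma hits_before_sum a x b : D a -> D x -> D b -> (a < x < b)%R ->
  P x (hits_before X b a) + P x (hits_before X a b) = 1.
Proof.
move=> Da Dx Db axb; have [ab ba] := interval_neq axb.
have mba := measurable_hits_before ba; have mab := measurable_hits_before ab.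
have <- : P x (hits_before X b a `|` hits_before X a b) =
    P x (hits_before X b a) + P x (hits_before X a b).
  apply: measureU => //; apply/seteqP; split => // w [[u [u0 Xu na]] [v [v0 Xv nb]]].
  have [uv|vu] := leP u v; first by apply: (nb u) Xu; rewrite u0.
  by apply: (na v) Xv; rewrite v0 ltW.
have mU : measurable (hits X a `|` hits X b) by apply: measurableU; exact: measurable_hits.
apply/le_anti/andP; split; first by apply: probability_le1; exact: measurableU.
have -> : 1 = P x (hits X a `|` hits X b).
  have := exit_interval Da Dx Db axb; rewrite probability_setC//.
  rewrite -(fineK (fin_num_measure (P x) _ mU)) -EFinB => -[h].
  by congr EFin; lra.
apply: prob_le_start => //; first exact: measurableU.
move=> w X0 [] [u u0 Xu].
  have [[]|[]|[na _ _ _]] := exit_trichotomy hX axb X0 u0; [by right|by left|].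
  by exfalso; apply: na; exists u => //; rewrite u0 lexx.
have [[]|[]|[_ nb _ _]] := exit_trichotomy hX axb X0 u0; [by right|by left|].
by exfalso; apply: nb; exists u => //; rewrite u0 lexx.
Qed.

Lemma hits_before_prob z y a : D z -> D y -> D a ->
  (a < z < y)%R \/ (y < z < a)%R ->
  P z (hits_before X y a) = ((s a - s z) / (s a - s y))%:E.
Proof.
move=> Dz Dy Da [azy|yza].
  rewrite hits_before_prob_up//; congr EFin.
  by rewrite -[LHS]mulrNN -invrN !opprB.
have := hits_before_sum Dy Dz Da yza; rewrite hits_before_prob_up//.
have [ya ay] := interval_neq yza.
rewrite -(fineK (fin_num_measure (P z) _ (measurable_hits_before ya))) -EFinD => -[h].
congr EFin; rewrite -[LHS](addKr ((s z - s y) / (s a - s y))%R) h.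
have ya' : (y < a)%R by move: yza => /andP[]; exact: lt_trans.
have nz : (s a - s y != 0)%R by rewrite gt_eqF// subr_gt0 scale_incr.
by field.
Qed.

Lemma hits_prob_ge z y a : D z -> D y -> D a ->
  (a < z < y)%R \/ (y < z < a)%R ->
  ((s a - s z) / (s a - s y))%:E <= P z (hits X y).
Proof.
move=> Dz Dy Da azy; rewrite -hits_before_prob//.
apply: le_measure; rewrite ?inE; [|exact: measurable_hits|exact: hits_before_hits].
by apply: measurable_hits_before; case: azy => /interval_neq[].
Qed.

(** A path from z which visits y stays, up to the time of the visit, in a
compact interval, hence visits y before almost every term of a sequence that
leaves all compact intervals. *)
Lemma hits_prob_le z y (a : nat -> R) (q : R) : D z -> D y -> (forall n, D (a n)) ->
  (forall c e, D c -> D e -> exists m, forall n, (m <= n)%N -> ~ (c <= a n <= e)%R) ->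
  (forall n, (a n < z < y)%R \/ (y < z < a n)%R) ->
  (forall n, ((s (a n) - s z) / (s (a n) - s y) <= q)%R) ->
  P z (hits X y) <= q%:E.
Proof.
move=> Dz Dy Da esc azy aq.
have ya n : y <> a n by case: (azy n) => /interval_neq[].
pose B m := \bigcap_n hits_before X y (a (m + n)%N).
have mB m : measurable (B m) by apply: bigcapT_measurable => n; exact: measurable_hits_before.
have BE : \bigcup_m B m = hits X y.
  apply/seteqP; split => [w [m _ /(_ 0%N I)]|w [u u0 Xu]].
    exact: hits_before_hits.
  have Xin : l < X u w < r by rewrite Xu.
  have [c [e [Dc De ce]]] := path_in_compact hX u0 Xin.
  have [m hm] := esc c e Dc De; exists m => // n _; exists u; split=> // v v0u Xv.
  by apply: (hm (m + n)%N (leq_addr _ _)); have := ce v v0u; rewrite Xv !lee_fin.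
have cvgB : (P z \o B) n @[n --> \oo] --> P z (hits X y).
  rewrite -BE; apply: nondecreasing_cvg_mu => //.
    by rewrite BE; exact: measurable_hits.
  move=> m n mn; apply/subsetPset => w Bw k _.
  have := Bw (n - m + k)%N I; by rewrite addnA subnKC.
rewrite -(cvg_lim (@ereal_hausdorff R) cvgB); apply: lime_le.
  by apply/cvg_ex; eexists; exact: cvgB.
apply: nearW => n /=; apply: (@le_trans _ _ (P z (hits_before X y (a n)))).
  apply: le_measure; rewrite ?inE//; first exact: measurable_hits_before.
  by move=> w /(_ 0%N I); rewrite addn0.
by rewrite hits_before_prob// lee_fin.
Qed.

(** The probability of a visit to y dominates that of a visit to y before a,
for every a on the far side of z. *)
Lemma hits_prob_sup z y (q : R) : D z -> D y ->
  (forall q', (q' < q)%R -> exists a, [/\ D a, (a < z < y)%R \/ (y < z < a)%R &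
    (q' <= (s a - s z) / (s a - s y))%R]) -> q%:E <= P z (hits X y).
Proof.
move=> Dz Dy h.
have hE := fineK (fin_num_measure (P z) _ (measurable_hits y)).
rewrite -hE lee_fin leNgt; apply/negP => lt.
have [|a [Da azy aq]] := h ((fine (P z (hits X y)) + q) / 2)%R; first by lra.
have := hits_prob_ge Dz Dy Da azy; rewrite -hE lee_fin; lra.
Qed.

(** Both solve for the position of the scale value sa at which the hitting
probability (sa - sz) / (sa - sy) exceeds a given level. *)
Lemma exit_quotient_ge_below (sa sz sy q : R) : (sz < sy)%R -> (q < 1)%R -> (sa < sz)%R ->
  (sa <= (sz - q * sy) / (1 - q))%R -> (q <= (sa - sz) / (sa - sy))%R.
Proof.
move=> zy q1 az; rewrite ler_pdivlMr ?subr_gt0// => h.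
rewrite -[leRHS]mulrNN -invrN !opprB ler_pdivlMr; last lra.
lra.
Qed.

Lemma exit_quotient_ge_above (sa sz sy q : R) : (sy < sz)%R -> (q < 1)%R -> (sz < sa)%R ->
  ((sz - q * sy) / (1 - q) <= sa)%R -> (q <= (sa - sz) / (sa - sy))%R.
Proof.
move=> zy q1 az; rewrite ler_pdivrMr ?subr_gt0// => h.
rewrite ler_pdivlMr; last lra.
lra.
Qed.

Lemma scale_lt_inv u v : D u -> D v -> (s u < s v)%R -> (u < v)%R.
Proof.
move=> Du Dv suv; rewrite ltNge; apply/negP => /(scale_nondecr Dv Du).
by rewrite leNgt suv.
Qed.

Lemma hits_prob_one_above z y : (forall M : R, exists2 u, D u & (s u < M)%R) ->
  D z -> D y -> (z < y)%R -> P z (hits X y) = 1.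
Proof.
move=> unb Dz Dy zy; apply/le_anti/andP; split.
  by apply: probability_le1; exact: measurable_hits.
apply: hits_prob_sup => // q' q'1.
have [a Da] := unb (Num.min (s z) ((s z - q' * s y) / (1 - q')))%R.
rewrite lt_min => /andP[az aq]; exists a; split => //.
  by left; rewrite zy andbT; exact: scale_lt_inv.
by apply: exit_quotient_ge_below => //; [exact: scale_incr|exact: ltW].
Qed.

Lemma hits_prob_one_below z y : (forall M : R, exists2 u, D u & (M < s u)%R) ->
  D z -> D y -> (y < z)%R -> P z (hits X y) = 1.
Proof.
move=> unb Dz Dy yz; apply/le_anti/andP; split.
  by apply: probability_le1; exact: measurable_hits.
apply: hits_prob_sup => // q' q'1.
have [a Da] := unb (Num.max (s z) ((s z - q' * s y) / (1 - q')))%R.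
rewrite gt_max => /andP[za qa]; exists a; split => //.
  by right; rewrite yz /=; exact: scale_lt_inv.
by apply: exit_quotient_ge_above => //; [exact: scale_incr|exact: ltW].
Qed.

(** The formula for a visit to y before a, in the limit where a tends to the
boundary point at which s has the finite limit S. *)
Lemma hits_prob_below (S : R) z y : (forall u, D u -> (s u < S)%R) ->
  (forall e : R, (0 < e)%R -> exists2 u, D u & (S - e < s u)%R) ->
  D z -> D y -> (y < z)%R -> P z (hits X y) = ((S - s z) / (S - s y))%:E.
Proof.
move=> s_lt s_sup Dz Dy yz; have syz := scale_incr Dy Dz yz; have szS := s_lt z Dz.
apply/le_anti/andP; split.
  have approach n : exists u, D u /\ (s z < s u)%R /\ (S - n.+1%:R^-1 < s u)%R.
    have e0 : (0 < Num.min (S - s z) n.+1%:R^-1)%R by rewrite lt_min subr_gt0 szS invr_gt0 ltr0n.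
    have [u Du su] := s_sup _ e0; exists u; split=> //.
    have h1 : (Num.min (S - s z) n.+1%:R^-1 <= S - s z)%R by rewrite ge_min lexx.
    have h2 : (Num.min (S - s z) n.+1%:R^-1 <= n.+1%:R^-1)%R by rewrite ge_min lexx orbT.
    move: (n.+1%:R^-1)%R (Num.min _ _) su h1 h2 => k m su h1 h2; split; lra.
  have [a ha] := choice approach.
  apply: (@hits_prob_le z y a) => //.
  - by move=> n; case: (ha n).
  - move=> c e Dc De; exists (Num.bound (S - s e)^-1) => n hn /andP[_ ae].
    have [Da [_ hS]] := ha n.
    have eS : (0 < S - s e)%R by rewrite subr_gt0 s_lt.
    have : ((S - s e)^-1 < n.+1%:R)%R.
      apply: (@lt_le_trans _ _ (Num.bound (S - s e)^-1)%:R).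
        by rewrite archi_boundP// invr_ge0 ltW.
      by rewrite ler_nat (leq_trans hn).
    rewrite -invf_plt ?posrE// => h.
    have := scale_nondecr Da De ae; move: (n.+1%:R^-1)%R h hS => k h hS; lra.
  - move=> n; right; rewrite yz/=; have [Da [za _]] := ha n.
    exact: scale_lt_inv.
  - move=> n; have [Da [za _]] := ha n; have aS := s_lt _ Da.
    rewrite ler_pdivrMr; last lra.
    rewrite mulrAC ler_pdivlMr; last lra.
    nra.
apply: hits_prob_sup => // q' q'q.
have q1 : ((S - s z) / (S - s y) < 1)%R by rewrite ltr_pdivrMr; lra.
have x0 : ((s z - q' * s y) / (1 - q') < S)%R.
  rewrite ltr_pdivrMr; last lra.
  by move: q'q; rewrite ltr_pdivlMr; lra.
have e0 : (0 < Num.min (S - s z) (S - (s z - q' * s y) / (1 - q')))%R.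
  by rewrite lt_min !subr_gt0 szS.
have [a Da] := s_sup _ e0; rewrite ltrBlDr -ltrBlDl lt_min => /andP[h1 h2].
exists a; split => //; first by right; rewrite yz; apply: scale_lt_inv => //; lra.
by apply: exit_quotient_ge_above => //; lra.
Qed.

Lemma hits_prob_above (S : R) z y : (forall u, D u -> (S < s u)%R) ->
  (forall e : R, (0 < e)%R -> exists2 u, D u & (s u < S + e)%R) ->
  D z -> D y -> (z < y)%R -> P z (hits X y) = ((S - s z) / (S - s y))%:E.
Proof.
move=> s_gt s_inf Dz Dy zy; have szy := scale_incr Dz Dy zy; have szS := s_gt z Dz.
have SE : ((S - s z) / (S - s y) = (s z - S) / (s y - S))%R.
  by rewrite -[RHS]mulrNN -invrN !opprB.
apply/le_anti/andP; split.
  have approach n : exists u, D u /\ (s u < s z)%R /\ (s u < S + n.+1%:R^-1)%R.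
    have e0 : (0 < Num.min (s z - S) n.+1%:R^-1)%R by rewrite lt_min subr_gt0 szS invr_gt0 ltr0n.
    have [u Du su] := s_inf _ e0; exists u; split=> //.
    have h1 : (Num.min (s z - S) n.+1%:R^-1 <= s z - S)%R by rewrite ge_min lexx.
    have h2 : (Num.min (s z - S) n.+1%:R^-1 <= n.+1%:R^-1)%R by rewrite ge_min lexx orbT.
    move: (n.+1%:R^-1)%R (Num.min _ _) su h1 h2 => k m su h1 h2; split; lra.
  have [a ha] := choice approach.
  apply: (@hits_prob_le z y a) => //.
  - by move=> n; case: (ha n).
  - move=> c e Dc De; exists (Num.bound (s c - S)^-1) => n hn /andP[ca _].
    have [Da [_ hS]] := ha n.
    have cS : (0 < s c - S)%R by rewrite subr_gt0 s_gt.
    have : ((s c - S)^-1 < n.+1%:R)%R.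
      apply: (@lt_le_trans _ _ (Num.bound (s c - S)^-1)%:R).
        by rewrite archi_boundP// invr_ge0 ltW.
      by rewrite ler_nat (leq_trans hn).
    rewrite -invf_plt ?posrE// => h.
    have := scale_nondecr Dc Da ca; move: (n.+1%:R^-1)%R h hS => k h hS; lra.
  - move=> n; left; rewrite zy andbT; have [Da [za _]] := ha n.
    exact: scale_lt_inv.
  - move=> n; have [Da [za _]] := ha n; have aS := s_gt _ Da.
    rewrite SE -[leLHS]mulrNN -invrN !opprB ler_pdivrMr; last lra.
    rewrite mulrAC ler_pdivlMr; last lra.
    nra.
rewrite SE; apply: hits_prob_sup => // q' q'q.
have q1 : ((s z - S) / (s y - S) < 1)%R by rewrite ltr_pdivrMr; lra.
have x0 : (S < (s z - q' * s y) / (1 - q'))%R.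
  rewrite ltr_pdivlMr; last lra.
  by move: q'q; rewrite ltr_pdivlMr; lra.
have e0 : (0 < Num.min (s z - S) ((s z - q' * s y) / (1 - q') - S))%R.
  by rewrite lt_min !subr_gt0 szS.
have [a Da] := s_inf _ e0; rewrite -ltrBlDl lt_min => /andP[h1 h2].
exists a; split => //; first by left; rewrite zy andbT; apply: scale_lt_inv => //; lra.
by apply: exit_quotient_ge_below => //; lra.
Qed.

End Hitting.

(** * Escape without return *)

Section CountableNull.
Context {d : measure_display} {T : measurableType d} {R : realType}.
Variable mu : {measure set T -> \bar R}.

Lemma negligible_bigcup_countable (I : countType) (N : I -> set T) :
  (forall i, mu.-negligible (N i)) -> mu.-negligible (\bigcup_i N i).
Proof.
move=> N0; rewrite (_ : \bigcup_i N i =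
    \bigcup_n (if unpickle n is Some i then N i else set0)).
  by apply: negligible_bigcup => n; case: unpickle => // ; exact: negligible_set0.
apply/seteqP; split => [w [i _ Ni]|w [n _]].
  by exists (pickle i); rewrite //= pickleK.
by case: unpickle => // i Ni; exists i.
Qed.

Lemma ae_forall_countable (I : countType) (Q : I -> T -> Prop) :
  (forall i, {ae mu, forall w, Q i w}) -> {ae mu, forall w, forall i, Q i w}.
Proof.
move=> h; have : mu.-negligible (\bigcup_i ~` Q i).
  by apply: negligible_bigcup_countable => i; exact: h.
apply: negligibleS => w /= nQ; apply: contrapT => nU; apply: nQ => i.
by apply: contrapT => nQi; apply: nU; exists i.
Qed.

End CountableNull.

Section Escape.
Variables (R : realType) (d : measure_display) (Omega : measurableType d).
Variables (l r : \bar R) (X : R -> Omega -> \bar R).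
Variables (theta : R -> Omega -> Omega) (P : R -> probability Omega R).
Variable s : R -> R.
Hypothesis hX : regular_diffusion l r X theta P.
Hypothesis hs : scale_function l r X P s.
Implicit Types (t u v a b x y z : R) (w : Omega) (A B : set Omega).
Local Notation D := (dom l r).
Local Notation Fnat := (natural_filtration X).
Local Notation Snat := (natural_sigma_algebra X).
Local Notation F := (filtration l r X P).

Lemma scale_ivt a b v : D a -> D b -> (a <= b)%R -> (s a <= v <= s b)%R ->
  exists2 y, (a <= y <= b)%R & s y = v.
Proof.
move=> Da Db ab /andP[av vb]; case: hs => _ s_cont _.
have sab := scale_nondecr hs Da Db ab.
have [|||y yab sy] := @IVT _ s a b v => //.
- apply: continuous_subspaceW s_cont => u; rewrite /= in_itv/=.
  exact: dom_interval.
- by rewrite min_l// max_r// av.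
by exists y => //; move: yab; rewrite in_itv.
Qed.

Lemma measurable_hits_after y t : (0 <= t)%R -> measurable (hits_after X y t).
Proof. by move=> t0; apply: (natural_measurable hX); exact: (hits_after_natural hX). Qed.

Lemma hits_after_prob z y : D z -> z <> y -> P z (hits_after X y 0) = P z (hits X y).
Proof.
move=> Dz zy; apply: (prob_eq_start hX) => //.
- exact: measurable_hits_after.
- exact: (measurable_hits hX).
move=> w X0; split => -[u u0 Xu]; exists u => //; first exact: ltW.
rewrite lt_neqAle u0 andbT; apply/eqP => u_; apply: zy; apply: EFin_inj.
by rewrite -X0 u_ Xu.
Qed.

(** The path leaves its starting point y into the open set O with probability
one, being likely to visit points of O arbitrarily close to y, and from O it
comes back to y. *)
Lemma hits_after_self y (O : set (\bar R)) : D y -> open O -> measurable O ->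
  O `<=` [set z | l < z < r] -> ~ O y%:E ->
  (forall z, D z -> O z%:E -> P z (hits X y) = 1) ->
  (forall q : R, (q < 1)%R -> exists a, [/\ D a, O a%:E & q%:E <= P y (hits X a)]) ->
  P y (hits_after X y 0) = 1.
Proof.
move=> Dy oO mO OD nOy back near.
pose V (q : rat) : set Omega := if (0 < q)%R then X (ratr q) @^-1` O else set0.
have mV q : measurable (V q).
  rewrite /V; case: ifP => // q0; rewrite -[_ @^-1` _]setTI.
  apply: (measurable_path hX) => //; first by rewrite ler0q ltW.
have mU : measurable (\bigcup_q V q) by exact: bigcupT_measurable_rat.
have UV : P y (\bigcup_q V q) = 1.
  apply/le_anti/andP; split; first exact: probability_le1.
  apply/lee_addgt0Pr => e e0; have [|a [Da Oa qa]] := near (1 - e)%R.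
    by rewrite gtrBl.
  rewrite -leeBlDr// -EFinB (le_trans qa)//.
  apply: (prob_le_start hX) => //; first exact: (measurable_hits hX).
  move=> w X0 [u u0 Xu]; have [|e' e'0 he] := path_open hX (w := w) u0 oO.
    by rewrite Xu.
  have ue : (u < u + e')%R by rewrite ltrDl.
  have [q] := rat_in_itvoo ue; rewrite in_itv/= => /andP[uq qe].
  have q0 : (0 < q)%R by rewrite -(ltr0q R) (le_lt_trans u0).
  exists q => //; rewrite /V q0; apply: he; first by rewrite ler0q ltW.
  by rewrite ltr0_norm ?subr_lt0//; lra.
have mH := @measurable_hits_after y 0 (lexx 0).
have VN q : (P y).-negligible (V q `\` hits_after X y 0).
  rewrite /V; case: ifP => q0; last by rewrite set0D; exact: negligible_set0.
  have q0' : (0 <= ratr q :> R)%R by rewrite ler0q ltW.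
  have SC : Snat (~` hits X y) by apply: generated_setC; exact: (hits_natural hX).
  have FV : F (ratr q) (X (ratr q) @^-1` O).
    apply: natural_filtration_filtration; apply: natural_filtration_preimage => //.
    by rewrite q0' lexx.
  have mVq := mV q; rewrite /V q0 in mVq.
  have Vin : X (ratr q) @^-1` O `<=` [set w | l < X (ratr q) w < r].
    by move=> w /OD.
  have := markov_property hX Dy q0' FV SC; rewrite (setIidl Vin).
  rewrite [RHS]integral0_eq => [null|w Vw]; last first.
    have [Dz zE] := dom_fine (Vin w Vw).
    rewrite probability_setC ?back ?subee//; last exact: (measurable_hits hX).
    by rewrite -zE.
  apply: (@negligibleS _ _ _ _ (X (ratr q) @^-1` O `&` [set w | (~` hits X y) (theta (ratr q) w)])).
    move=> w [Vw nh]; split=> // -[u u0]; rewrite (diff_shift hX)// => Xu.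
    apply: nh; exists (ratr q + u)%R => //; rewrite ltr_wpDr//.
    by rewrite ltr0q.
  apply/negligibleP => //; apply: measurableI => //.
  by apply: (natural_measurable hX); exact: (shift_natural hX).
have N0 : P y (~` hits_after X y 0) = 0.
  apply/negligibleP; first exact: measurableC.
  apply: (@negligibleS _ _ _ _ (~` (\bigcup_q V q) `|` \bigcup_q (V q `\` hits_after X y 0))).
    move=> w nh; have [[q _ Vq]|nU] := pselect ((\bigcup_q V q) w); last by left.
    by right; exists q.
  apply: negligibleU; last exact: negligible_bigcup_countable.
  apply/negligibleP; first exact: measurableC.
  have : P y (~` \bigcup_q V q) = 0 by rewrite probability_setC// UV subee.
  by [].
move: N0; rewrite probability_setC//.
rewrite -(fineK (fin_num_measure (P y) _ mH)) -EFinB => -[h].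
by congr EFin; lra.
Qed.

(** The diffusion started at y reaches a point c above y before a with
probability tending to 0 as a tends to y from below, since s is continuous. *)
Lemma hits_near_below y (q : R) : D y -> (q < 1)%R ->
  exists a, [/\ D a, (a < y)%R & q%:E <= P y (hits X a)].
Proof.
move=> Dy q1; have [a0 [c [Da0 Dc /andP[a0y yc]]]] := dom_open Dy.
have s0 := scale_incr hs Da0 Dy a0y; have s1 := scale_incr hs Dy Dc yc.
pose q' := Num.max q 2^-1%R.
have q'0 : (0 < q')%R by rewrite lt_max invr_gt0 ltr0n orbT.
have q'1 : (q' < 1)%R by rewrite gt_max q1 invf_lt1// ltr1n.
(* the second term is the scale value at which (s c - s y) / (s c - v) = q' *)
pose v := Num.max (s a0) (s c - (s c - s y) / q')%R.
have vy : (v < s y)%R.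
  rewrite gt_max s0/= ltrBlDr -ltrBlDl ltr_pdivlMr//; nra.
have [||a /andP[a0a ay] sa] := @scale_ivt a0 y v Da0 Dy; first exact: ltW.
  by rewrite le_max lexx/= ltW.
have Da : D a by apply: (dom_interval Da0 Dy); rewrite a0a.
have ay' : (a < y)%R by apply: (scale_lt_inv hs) => //; rewrite sa.
exists a; split => //; apply: (@le_trans _ _ q'%:E).
  by rewrite lee_fin le_max lexx.
apply: (@le_trans _ _ ((s c - s y) / (s c - s a))%:E); last first.
  by apply: (hits_prob_ge hX hs) => //; right; rewrite ay'.
rewrite lee_fin sa ler_pdivlMr; last lra.
rewrite mulrC -ler_pdivlMr// lerBlDr -lerBlDl le_max.
by rewrite lexx orbT.
Qed.

Lemma hits_near_above y (q : R) : D y -> (q < 1)%R ->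
  exists a, [/\ D a, (y < a)%R & q%:E <= P y (hits X a)].
Proof.
move=> Dy q1; have [c [a0 [Dc Da0 /andP[cy ya0]]]] := dom_open Dy.
have s0 := scale_incr hs Dy Da0 ya0; have s1 := scale_incr hs Dc Dy cy.
pose q' := Num.max q 2^-1%R.
have q'0 : (0 < q')%R by rewrite lt_max invr_gt0 ltr0n orbT.
have q'1 : (q' < 1)%R by rewrite gt_max q1 invf_lt1// ltr1n.
pose v := Num.min (s a0) (s c + (s y - s c) / q')%R.
have vy : (s y < v)%R.
  rewrite lt_min s0/= -ltrBlDl ltr_pdivlMr//; nra.
have [||a /andP[ya aa0] sa] := @scale_ivt y a0 v Dy Da0; first exact: ltW.
  by rewrite ge_min lexx/= ltW.
have Da : D a by apply: (dom_interval Dy Da0); rewrite ya.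
have ya' : (y < a)%R by apply: (scale_lt_inv hs) => //; rewrite sa.
exists a; split => //; apply: (@le_trans _ _ q'%:E).
  by rewrite lee_fin le_max lexx.
apply: (@le_trans _ _ ((s c - s y) / (s c - s a))%:E); last first.
  by apply: (hits_prob_ge hX hs) => //; left; rewrite cy.
rewrite lee_fin sa -[leRHS]mulrNN -invrN !opprB ler_pdivlMr; last lra.
rewrite mulrC -ler_pdivlMr// lerBlDl ge_min.
by rewrite lexx orbT.
Qed.

(** Starting at y the path returns to y: it enters (l, y) at once, and from
there it visits y almost surely. *)
Lemma no_return_prob_right (S : R) y z : (forall M : R, exists2 u, D u & (s u < M)%R) ->
  (forall u, D u -> (s u < S)%R) ->
  (forall e : R, (0 < e)%R -> exists2 u, D u & (S - e < s u)%R) ->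
  D y -> D z -> P z (~` hits_after X y 0) = (escape_prob s S y z)%:E.
Proof.
move=> unb s_lt s_sup Dy Dz; have s_incr := scale_incr hs.
rewrite probability_setC; last exact: measurable_hits_after.
have [zy|yz|zy] := ltgtP z y.
- rewrite hits_after_prob//; last by move=> h; move: zy; rewrite h ltxx.
  rewrite (hits_prob_one_above hX hs unb)// subee//.
  by rewrite (@escape_prob_eq0 _ l r s S) //; exact: ltW.
- rewrite hits_after_prob//; last by move=> h; move: yz; rewrite h ltxx.
  rewrite (hits_prob_below hX hs s_lt s_sup)// -EFinB.
  rewrite (@escape_probE _ l r s S) //; last exact: ltW.
  congr EFin; have Sy := s_lt y Dy.
  have nz : (S - s y != 0)%R by rewrite gt_eqF// subr_gt0.
  by field.
have [/andP[ly yr] ltyy] := (Dy, ltxx y%:E).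
rewrite zy (@hits_after_self y [set u | l < u < y%:E]) // ?ltyy ?andbF//.
- by rewrite subee// (@escape_prob_eq0 _ l r s S) .
- exact: open_interval.
- rewrite (_ : [set u | _] = [set` `]l, y%:E[]); first exact: emeasurable_itv.
  by apply/seteqP; split => u; rewrite /= in_itv.
- by move=> u /andP[lu uy]; rewrite /= lu (lt_trans uy).
- by rewrite /= ltyy andbF.
- by move=> u Du /andP[_ uy]; apply: (hits_prob_one_above hX hs unb).
- move=> q q1; have [a [Da ay qa]] := hits_near_below Dy q1.
  by exists a; split => //; have /andP[la _] := Da; rewrite /= la lte_fin.
Qed.

Lemma no_return_prob_left (S : R) y z : (forall M : R, exists2 u, D u & (M < s u)%R) ->
  (forall u, D u -> (S < s u)%R) ->
  (forall e : R, (0 < e)%R -> exists2 u, D u & (s u < S + e)%R) ->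
  D y -> D z -> P z (~` hits_after X y 0) = (escape_prob s S y z)%:E.
Proof.
move=> unb s_gt s_inf Dy Dz; have s_incr := scale_incr hs.
have Sy := s_gt y Dy; rewrite probability_setC; last exact: measurable_hits_after.
have phiE : escape_prob s S y z = Num.max 0%R ((s y - s z) / (s y - S))%R.
  by rewrite /escape_prob -(mulrNN (s z - s y)%R) -invrN !opprB.
have [zy|yz|zy] := ltgtP z y.
- rewrite hits_after_prob//; last by move=> h; move: zy; rewrite h ltxx.
  rewrite (hits_prob_above hX hs s_gt s_inf)// -EFinB phiE.
  have szy := s_incr _ _ Dz Dy zy.
  rewrite (max_idPr _); last by rewrite divr_ge0// subr_ge0 ltW.
  congr EFin; have nz : (S - s y != 0)%R by rewrite lt_eqF// subr_lt0.
  have nz' : (s y - S != 0)%R by rewrite gt_eqF// subr_gt0.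
  by field; rewrite nz nz'.
- rewrite hits_after_prob//; last by move=> h; move: yz; rewrite h ltxx.
  rewrite (hits_prob_one_below hX hs unb)// subee// phiE (max_idPl _)//.
  by rewrite pmulr_lle0 ?invr_gt0 ?subr_gt0// subr_le0 ltW// s_incr.
have [/andP[ly yr] ltyy] := (Dy, ltxx y%:E).
rewrite zy in phiE *; rewrite (@hits_after_self y [set u | y%:E < u < r]) //.
- by rewrite subee// phiE subrr mul0r maxxx.
- exact: open_interval.
- rewrite (_ : [set u | _] = [set` `]y%:E, r[]); first exact: emeasurable_itv.
  by apply/seteqP; split => u; rewrite /= in_itv.
- by move=> u /andP[lu uy]; rewrite /= uy andbT (lt_trans ly).
- by rewrite /= ltyy.
- by move=> u Du /andP[uy _]; apply: (hits_prob_one_below hX hs unb).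
- move=> q q1; have [a [Da ay qa]] := hits_near_above Dy q1.
  by exists a; split => //; have /andP[_ la] := Da; rewrite /= la lte_fin ay.
Qed.

End Escape.

(** * The submartingales as functions of the position *)

Section CondExpUnique.
Variables (R : realType) (d : measure_display) (T : measurableType d).
Variable mu : probability T R.

(** The set where W < V is the union over rational q of the sets where
W < q < V; each of these is an intersection of two events of G, so that V and W
have the same integral on it, which forces it to be null. *)
Lemma cond_exp_unique_le (G : set (set T)) (V W : T -> R) :
  (forall A B, G A -> G B -> G (A `&` B)) -> G `<=` measurable ->
  adapted_to G V -> adapted_to G W ->
  mu.-integrable setT (EFin \o V) -> mu.-integrable setT (EFin \o W) ->
  (forall A, G A -> \int[mu]_(w in A) (V w)%:E = \int[mu]_(w in A) (W w)%:E) ->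
  {ae mu, forall w, (V w <= W w)%R}.
Proof.
move=> GI Gm aV aW iV iW VW.
pose A (q : rat) := (V @^-1` `]ratr q, +oo[) `&` (W @^-1` `]-oo, ratr q[).
apply: (@negligibleS _ _ _ _ (\bigcup_q A q)).
  move=> w /= /negP; rewrite -ltNge => WV; have [q] := rat_in_itvoo WV.
  rewrite in_itv/= => /andP[Wq qV]; exists q => //.
  by split; rewrite /= in_itv/= ?andbT.
apply: negligible_bigcup_countable => q.
have GA : G (A q) by apply: GI; [apply: aV|apply: aW]; exact: measurable_itv.
have mA := Gm _ GA.
have iVA := integrableS measurableT mA (@subsetT _ _) iV.
have iWA := integrableS measurableT mA (@subsetT _ _) iW.
have VWA w : A q w -> (W w < V w)%R.
  by move=> []; rewrite /= !in_itv/= andbT => h1 h2; exact: lt_trans h1.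
have int0 : \int[mu]_(w in A q) `|(V w - W w)%:E| = 0.
  transitivity (\int[mu]_(w in A q) ((V w)%:E - (W w)%:E)).
    apply: eq_integral => w /set_mem /VWA h.
    by rewrite gee0_abs ?EFinB// lee_fin subr_ge0 ltW.
  rewrite integralB//= VW// subee//; exact: integrable_fin_num.
have mVW : measurable_fun (A q) (fun w => (V w - W w)%:E).
  rewrite (_ : (fun w => (V w - W w)%:E) = (EFin \o V) \- (EFin \o W))//.
  apply: emeasurable_funB; [exact: measurable_int iVA|exact: measurable_int iWA].
have := (ae_eq_integral_abs mu mA mVW).1 int0.
apply: negligibleS => w Aw /= h; have /eqP := h Aw.
by rewrite eqe subr_eq0 gt_eqF// VWA.
Qed.

Lemma cond_exp_unique (G : set (set T)) (Y V W : T -> R) :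
  (forall A B, G A -> G B -> G (A `&` B)) -> G `<=` measurable ->
  is_cond_exp mu G Y V -> is_cond_exp mu G Y W ->
  {ae mu, forall w, V w = W w}.
Proof.
move=> GI Gm [aV iV VY] [aW iW WY].
have VW A : G A -> \int[mu]_(w in A) (V w)%:E = \int[mu]_(w in A) (W w)%:E.
  by move=> GA; rewrite VY// WY.
have h1 := cond_exp_unique_le GI Gm aV aW iV iW VW.
have h2 := cond_exp_unique_le GI Gm aW aV iW iV (fun A GA => esym (VW A GA)).
apply: filterS2 h1 h2 => w h1 h2; apply/le_anti; rewrite h1; exact: h2.
Qed.

End CondExpUnique.

Section Azema.
Variables (R : realType) (d : measure_display) (Omega : measurableType d).
Variables (l r : \bar R) (X : R -> Omega -> \bar R).
Variables (theta : R -> Omega -> Omega) (P : R -> probability Omega R).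
Hypothesis hX : regular_diffusion l r X theta P.
Implicit Types (t u v a b x y z : R) (w : Omega) (A B : set Omega).
Local Notation D := (dom l r).
Local Notation Fnat := (natural_filtration X).
Local Notation Snat := (natural_sigma_algebra X).
Local Notation F := (filtration l r X P).
Variable phi : R -> R -> R.
Hypothesis no_return : forall y z, D y -> D z ->
  P z (~` hits_after X y 0) = (phi y z)%:E.

(** An absorbed path makes no further visit to an interior point, whence the
value 1 at the boundary. *)
Definition boundary_one (f : R -> R) (z : \bar R) : R :=
  if l < z < r then f (fine z) else 1%R.

Lemma boundary_one_comp_measurable d' (T : measurableType d') (f : R -> T -> R)
    (v : T -> \bar R) : measurable_fun setT v ->
  measurable_fun [set p | l < v p < r] (fun p => f (fine (v p)) p) ->
  measurable_fun setT (fun p => boundary_one (f^~ p) (v p)).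
Proof.
move=> mv mf.
have mI : measurable [set p | l < v p < r].
  rewrite (_ : [set p | _] = setT `&` v @^-1` [set` `]l, r[]).
    by apply: mv => //; exact: emeasurable_itv.
  by rewrite setTI; apply/seteqP; split => p; rewrite /= in_itv.
apply: measurable_fun_if => //.
- by apply: (measurable_fun_bool true); rewrite setTI.
- by rewrite setTI.
Qed.

Lemma no_return_measurable y : D y -> measurable_fun D (phi y).
Proof.
move=> Dy; apply/measurable_EFinP.
have SN : Snat (~` hits_after X y 0).
  by apply: generated_setC; exact: (hits_after_natural hX).
apply: eq_measurable_fun (diff_kernel hX SN) => z /set_mem Dz /=.
by rewrite no_return.
Qed.

Lemma no_return_bounds y z : D y -> D z -> (0 <= phi y z <= 1)%R.
Proof.
move=> Dy Dz; rewrite -!lee_fin -no_return// measure_ge0/=.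
by apply: probability_le1; apply: measurableC; exact: (measurable_hits_after hX).
Qed.

Lemma boundary_one_bounds y (z : \bar R) : D y -> (0 <= boundary_one (phi y) z <= 1)%R.
Proof.
move=> Dy; rewrite /boundary_one; case: ifP => [/dom_fine[Dz _]|_].
  exact: no_return_bounds.
by rewrite ler01 lexx.
Qed.

Lemma last_passage_after y t : D y -> (0 <= t)%R ->
  [set w | last_passage l r X y w <= t%:E] = ~` hits_after X y t.
Proof.
move=> Dy t0; apply/seteqP; split => w.
  by move=> /(last_passage_le hX w Dy t0) h [u tu Xu]; exact: h Xu.
by move=> h; apply/(last_passage_le hX w Dy t0) => u tu Xu; apply: h; exists u.
Qed.

(** After time t the path visits y with the probability of a return, computed
from X t by the Markov property; once absorbed it never does. *)
Lemma azema_version x y t : D x -> D y -> (0 <= t)%R ->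
  is_cond_prob (P x) (F t) [set w | last_passage l r X y w <= t%:E]
    (fun w => boundary_one (phi y) (X t w)).
Proof.
move=> Dx Dy t0; set V := fun w => boundary_one (phi y) (X t w); rewrite last_passage_after//.
set L := ~` hits_after X y t.
have mL : measurable L by apply: measurableC; exact: (measurable_hits_after hX).
have mphi : measurable_fun setT (boundary_one (phi y)).
  apply: (@boundary_one_comp_measurable _ _ (fun z _ => phi y z) id) => //.
  apply: (measurable_comp (F := D)) (no_return_measurable Dy) _ => //.
  - by apply: is_interval_measurable; exact: dom_interval.
  - by move=> _ [z /dom_fine[Dz _] <-].
  - exact: measurable_funTS.
have adV : adapted_to (F t) V.
  move=> B mB; apply: natural_filtration_filtration.
  rewrite (_ : V @^-1` B = X t @^-1` (boundary_one (phi y) @^-1` B))//.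
  apply: natural_filtration_preimage; first by rewrite t0 lexx.
  by rewrite -[X in measurable X]setTI; exact: mphi.
have mV : measurable_fun setT V.
  by apply: measurableT_comp => //; exact: (measurable_path hX).
have V01 w : (0 <= V w <= 1)%R by exact: boundary_one_bounds.
split => //.
  apply: (@le_integrable _ _ _ (P x) setT measurableT _ (EFin \o cst 1%R)).
  - exact/measurable_EFinP.
  - move=> w _ /=; have /andP[V0 V1] := V01 w.
    by rewrite lee_fin ger0_norm// normr1.
  - by apply: finite_measure_integrable_cst.
move=> A FA; have mA := filtration_measurable hX t0 FA.
have mI := measurable_interior hX t0.
rewrite integral_indic//.
pose I := [set w | l < X t w < r].
have mAI : measurable (A `&` I) by exact: measurableI.
have mAD : measurable (A `\` I) by exact: measurableD.
have AE : A = (A `&` I) `|` (A `\` I) by rewrite setUIDK.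
have SN : Snat (~` hits_after X y 0).
  by apply: generated_setC; exact: (hits_after_natural hX).
rewrite {1}AE ge0_integral_setU//; first last.
- by rewrite disj_set2E; apply/eqP/seteqP; split => // w [[_ h] [_]].
- by move=> w _; rewrite lee_fin; case/andP: (V01 w).
- by rewrite -AE; apply/measurable_EFinP; apply: measurable_funS mV.
have -> : \int[P x]_(w in A `&` I) (V w)%:E =
    \int[P x]_(w in A `&` I) P (fine (X t w)) (~` hits_after X y 0).
  apply: eq_integral => w /set_mem[_ Iw]; have [Dz _] := dom_fine Iw.
  by rewrite /V /boundary_one Iw no_return.
rewrite -(markov_property hX Dx t0 FA SN).
have -> : \int[P x]_(w in A `\` I) (V w)%:E = P x (A `\` I).
  rewrite -[RHS]mul1e -integral_cst//; apply: eq_integral => w /set_mem[_ Iw].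
  by rewrite /V /boundary_one; move/negP/negbTE: Iw => ->.
have boundary w : ~ I w -> L w.
  move=> nI [u tu Xu]; apply: nI; apply: (interior_before hX (t := u)).
    by rewrite t0 ltW.
  by rewrite Xu.
have shiftE w : (~` hits_after X y 0) (theta t w) <-> L w.
  split=> h [u tu Xu]; apply: h.
    exists (u - t)%R; first by rewrite subr_gt0.
    have ut0 : (0 <= u - t)%R by rewrite subr_ge0 ltW.
    by rewrite (diff_shift hX)// subrKC.
  exists (t + u)%R; first by rewrite ltrDl.
  by rewrite -(diff_shift hX)// ltW.
rewrite [RHS](measureDI (P x) (measurableI _ _ mL mA) mI) addeC; congr (_ + _).
  congr (P x _); apply/seteqP; split => w.
    by move=> [Aw nI]; split=> //; split => //; exact: boundary.
  by move=> [[_ Aw] nI].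
congr (P x _); apply/seteqP; split => w.
  by move=> [[Aw Iw] /shiftE Lw].
by move=> [[Lw Aw] Iw]; split => //; apply/shiftE.
Qed.

Lemma azema_ae x y t (W : Omega -> R) : D x -> D y -> (0 <= t)%R ->
  is_cond_prob (P x) (F t) [set w | last_passage l r X y w <= t%:E] W ->
  {ae P x, forall w, W w = boundary_one (phi y) (X t w)}.
Proof.
move=> Dx Dy t0 hW; apply: cond_exp_unique hW (azema_version Dx Dy t0).
- exact: (filtrationI hX).
- by move=> A; exact: (filtration_measurable hX).
Qed.

End Azema.

(** * The inaccessible boundary and convexity of g *)

(** The difference of the integrals is that of |g - f|, which equals g - f almost
everywhere. *)
Lemma ae_le_integral d (T : measurableType d) (R : realType)
    (mu : {measure set T -> \bar R}) (f g : T -> R) :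
  mu.-integrable setT (EFin \o f) -> mu.-integrable setT (EFin \o g) ->
  {ae mu, forall w, (f w <= g w)%R} ->
  \int[mu]_w (f w)%:E <= \int[mu]_w (g w)%:E.
Proof.
move=> fi gi fg; rewrite -sube_ge0; last first.
  by apply/orP; left; exact: integrable_fin_num fi.
rewrite -integralB//.
have mf := measurable_int _ fi; have mg := measurable_int _ gi.
have mB := emeasurable_funB mg mf.
rewrite (@ae_eq_integral _ _ _ mu setT (abse \o ((EFin \o g) \- (EFin \o f))))//.
- by apply: integral_ge0 => w _; exact: abse_ge0.
- exact: measurableT_comp.
- by apply: filterS fg => w fgw _ /=; rewrite ger0_norm ?subr_ge0// EFinB.
Qed.

Section BoundaryAndConvexity.
Variables (R : realType) (d : measure_display) (Omega : measurableType d).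
Variables (l r : \bar R) (X : R -> Omega -> \bar R).
Variables (theta : R -> Omega -> Omega) (P : R -> probability Omega R).
Variable s : R -> R.
Hypothesis hX : regular_diffusion l r X theta P.
Hypothesis hs : scale_function l r X P s.
Implicit Types (t u v a b x y z : R) (w : Omega) (A B : set Omega).
Local Notation D := (dom l r).
Local Notation Fnat := (natural_filtration X).
Local Notation Snat := (natural_sigma_algebra X).
Local Notation F := (filtration l r X P).

Lemma ae_starts x : D x -> {ae P x, forall w, X 0%R w = x%:E}.
Proof.
move=> Dx; apply/negligibleP; first by apply: measurableC; exact: (measurable_starts hX).
have : P x (~` starts X x) = 0.
  rewrite probability_setC ?(diff_start hX Dx) ?subee//.
  exact: (measurable_starts hX).
by [].
Qed.

Lemma ae_hits_rat x (Q : R -> Prop) :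
  (forall q, D q -> Q q -> P x (hits X q) = 1) ->
  {ae P x, forall w, forall q : rat, D (ratr q) -> Q (ratr q) -> hits X (ratr q) w}.
Proof.
move=> hq; apply: ae_forall_countable => q.
have [[Dq Qq]|nQ] := pselect (D (ratr q) /\ Q (ratr q)); last first.
  by apply: aeW => w Dq Qq; exfalso; apply: nQ.
have mH := measurable_hits hX (ratr q).
apply: (@negligibleS _ _ _ _ (~` hits X (ratr q))).
  by move=> w h Hw; apply: h => _ _.
apply/negligibleP; first exact: measurableC.
have : P x (~` hits X (ratr q)) = 0 by rewrite probability_setC// hq// subee.
by [].
Qed.

(** A path absorbed at l has a maximum below r, and then misses the points
between this maximum and r. *)
Lemma unreachable_left x : D x ->
  (forall q, D q -> (x < q)%R -> P x (hits X q) = 1) ->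
  {ae P x, forall w, forall t, (0 <= t)%R -> X t w <> l}.
Proof.
move=> Dx hq; have := ae_hits_rat hq; have := ae_starts Dx.
apply: filterS2 => w X0 hits_w t t0 Xl.
have [/andP[lx xr]] := Dx.
have K0 : ((fun u => X u w) @` `[0%R, t]) !=set0.
  by exists (X t w), t => //; rewrite /= in_itv/= t0 lexx.
have cc := continuous_subspaceT (A := (fun u => X u w) @` `[0%R, t])
  (@contract_continuous R).
have cK := path_segment_compact hX (w := w) (b := t) (lexx 0%R).
have [c + cmax] := compact_EVT_max K0 cK cc.
rewrite inE => -[v]; rewrite /= in_itv/= => /andP[v0 vt] Xv.
have le_c u : (0 <= u <= t)%R -> X u w <= c.
  move=> ut; rewrite -(@le_contract R); apply: cmax; rewrite inE.
  by exists u => //; rewrite /= in_itv.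
have cr : c < r.
  have /andP[_ Xr] := diff_range hX w v0; rewrite -Xv lt_neqAle Xr andbT.
  apply/eqP => Xvr; have := diff_absorbing hX (u := v) (t := t) (w := w).
  rewrite v0 vt Xl Xvr => /(_ isT (or_intror erefl)) lr.
  by move: (lt_trans lx xr); rewrite lr ltxx.
have xc : x%:E <= c by rewrite -X0; apply: le_c; rewrite lexx.
have [|Dc cE] := @dom_fine _ l r c; first by rewrite (lt_le_trans lx xc).
have [_ [b [_ Db /andP[_ cb]]]] := dom_open Dc.
have [q] := rat_in_itvoo cb; rewrite in_itv/= => /andP[cq qb].
have Dq : D (ratr q) by apply: (dom_interval Dc Db); rewrite !ltW.
have xq : (x < ratr q)%R by rewrite (le_lt_trans _ cq)// -lee_fin -cE.
have [u u0 Xu] := hits_w q Dq xq.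
have [ut|tu] := leP u t.
  have := le_c u; rewrite u0 ut Xu cE lee_fin => /(_ isT).
  by rewrite leNgt cq.
have := diff_absorbing hX (u := t) (t := u) (w := w).
rewrite t0 (ltW tu) Xu Xl => /(_ isT (or_introl erefl)) ql.
by move: Dq => /andP[]; rewrite ql ltxx.
Qed.

Lemma unreachable_right x : D x ->
  (forall q, D q -> (q < x)%R -> P x (hits X q) = 1) ->
  {ae P x, forall w, forall t, (0 <= t)%R -> X t w <> r}.
Proof.
move=> Dx hq; have := @ae_hits_rat x (fun q => (q < x)%R) hq; have := ae_starts Dx.
apply: filterS2 => w X0 hits_w t t0 Xl.
have [/andP[lx xr]] := Dx.
have K0 : ((fun u => X u w) @` `[0%R, t]) !=set0.
  by exists (X t w), t => //; rewrite /= in_itv/= t0 lexx.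
have cc := continuous_subspaceT (A := (fun u => X u w) @` `[0%R, t])
  (@contract_continuous R).
have cK := path_segment_compact hX (w := w) (b := t) (lexx 0%R).
have [c + cmin] := compact_EVT_min K0 cK cc.
rewrite inE => -[v]; rewrite /= in_itv/= => /andP[v0 vt] Xv.
have ge_c u : (0 <= u <= t)%R -> c <= X u w.
  move=> ut; rewrite -(@le_contract R); apply: cmin; rewrite inE.
  by exists u => //; rewrite /= in_itv.
have lc : l < c.
  have /andP[Xr _] := diff_range hX w v0; rewrite -Xv lt_neqAle Xr andbT.
  apply/eqP => Xvr; have := diff_absorbing hX (u := v) (t := t) (w := w).
  rewrite v0 vt Xl -Xvr => /(_ isT (or_introl erefl)) rl.
  by move: (lt_trans lx xr); rewrite rl ltxx.
have cx : c <= x%:E by rewrite -X0; apply: ge_c; rewrite lexx.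
have [|Dc cE] := @dom_fine _ l r c; first by rewrite lc (le_lt_trans cx xr).
have [b [_ [Db _ /andP[bc _]]]] := dom_open Dc.
have [q] := rat_in_itvoo bc; rewrite in_itv/= => /andP[bq qc].
have Dq : D (ratr q) by apply: (dom_interval Db Dc); rewrite !ltW.
have qx : (ratr q < x)%R by rewrite (lt_le_trans qc)// -lee_fin -cE.
have [u u0 Xu] := hits_w q Dq qx.
have [ut|tu] := leP u t.
  have := ge_c u; rewrite u0 ut Xu cE lee_fin => /(_ isT).
  by rewrite leNgt qc.
have := diff_absorbing hX (u := t) (t := u) (w := w).
rewrite t0 (ltW tu) Xu Xl => /(_ isT (or_intror erefl)) qr.
by move: Dq => /andP[_]; rewrite qr ltxx.
Qed.

(** The submartingale inequality between time 0 and the exit time from (a, b).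
A monotone g is bounded on [a, b], so that letting the time tend to infinity is
a matter of bounded convergence. *)
Lemma subharmonic_scale_convex (g : R -> R) : subharmonic l r X P g ->
  (forall u, D u -> (0 <= g u)%R) ->
  (forall a u b, D a -> D b -> (a <= u <= b)%R -> (g u <= Num.max (g a) (g b))%R) ->
  forall a x b, D a -> D x -> D b -> (a < x < b)%R ->
    (g x * (s b - s a) <= g a * (s b - s x) + g b * (s x - s a))%R.
Proof.
move=> [mg sub] g0 gmax a x b Da Dx Db axb; have [ab ba] := interval_neq axb.
have altb : (a < b)%R by move: axb => /andP[]; exact: lt_trans.
have [la br] : l < a%:E /\ b%:E < r by move: Da Db => /andP[? _] /andP[_ ?].
pose M t w := g (fine (X (fine (mine t%:E (exit_time X a b w))) w)).
have [[sub1 sub2] _] : submartingale (P x) F M /\ uniformly_integrable (P x) M.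
  exact: sub.
pose C := Num.max (g a) (g b).
have C0 : (0 <= C)%R by rewrite le_max g0.
have mhab := measurable_hits_before hX ab; have mhba := measurable_hits_before hX ba.
pose pa := fine (P x (hits_before X a b)); pose pb := fine (P x (hits_before X b a)).
have paE : pa%:E = P x (hits_before X a b) by rewrite fineK// fin_num_measure.
have pbE : pb%:E = P x (hits_before X b a) by rewrite fineK// fin_num_measure.
have M0 : \int[P x]_w (M 0%R w)%:E = (g x)%:E.
  have -> : \int[P x]_w (M 0%R w)%:E = \int[P x]_w (g x)%:E.
    apply: ae_eq_integral => //.
    - by have [_ /measurable_int] := sub1 0%R (lexx _).
    - apply: filterS (ae_starts Dx) => w X0 _; congr EFin.
      by rewrite /M min_l ?X0//; apply: le_ereal_inf_tmp => _ [u [u0 _] <-]; rewrite lee_fin.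
  have PT : P x setT = 1 by exact: probability_setT.
  by rewrite integral_cst// [X in _ * X]PT mule1.
have Mle t : (0 <= t)%R -> (g x)%:E <= \int[P x]_w (M t w)%:E.
  move=> t0; have [|W [_ iW WE] MW] := sub2 0%R t; first by rewrite lexx.
  rewrite -M0 -(WE setT) ?(filtrationT hX)//; last exact: filtrationT.
  by apply: ae_le_integral => //; case: (sub1 0%R (lexx _)).
have bound n : (g x)%:E <= (g a * pa + g b * pb)%:E + C%:E * P x (stays X a b n%:R).
  have n0 : (0 <= n%:R :> R)%R := ler0n R n.
  apply: (le_trans (Mle n%:R n0)).
  have mst := measurable_stays hX a b n0.
  pose H w := (g a * \1_(hits_before X a b) w + g b * \1_(hits_before X b a) w +
    C * \1_(stays X a b n%:R) w)%R.
  have iI A (k : R) : measurable A -> (P x).-integrable setT (fun w => k%:E * (\1_A w)%:E).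
    by move=> mA; apply: integrableZl => //; exact: integrable_indic.
  have HE : (EFin \o H) = (fun w => (g a)%:E * (\1_(hits_before X a b) w)%:E +
      (g b)%:E * (\1_(hits_before X b a) w)%:E + C%:E * (\1_(stays X a b n%:R) w)%:E).
    by apply/funext => w; rewrite /H/= !EFinD !EFinM.
  have iD2 : (P x).-integrable setT (fun w => (g a)%:E * (\1_(hits_before X a b) w)%:E +
      (g b)%:E * (\1_(hits_before X b a) w)%:E).
    by apply: integrableD => //; exact: iI.
  have iH : (P x).-integrable setT (EFin \o H).
    by rewrite HE; apply: integrableD => //; exact: iI.
  have intI A (k : R) : measurable A -> \int[P x]_w (k%:E * (\1_A w)%:E) = k%:E * P x A.
    by move=> mA; rewrite integralZl ?integral_indic ?setIT//; exact: integrable_indic.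
  have -> : (g a * pa + g b * pb)%:E + C%:E * P x (stays X a b n%:R) = \int[P x]_w (H w)%:E.
    rewrite -[RHS]/(\int[P x]_w (EFin \o H) w) HE integralD//; last exact: iI.
    rewrite integralD//; [|exact: iI..]; rewrite !intI// -paE -pbE.
    by rewrite -!EFinM -EFinD.
  apply: ae_le_integral => //; first by case: (sub1 n%:R n0).
  apply: filterS (ae_starts Dx) => w X0; rewrite /M /H.
  have [[Tb _ ->]|[Tb _ ->]|[na nb -> Xn]] := exit_trichotomy hX axb X0 n0.
  - rewrite !indicE (mem_set Tb) mulr1 /= -addrA lerDl.
    by rewrite addr_ge0// mulr_ge0// g0.
  - rewrite !indicE (mem_set Tb) mulr1 /= -addrA addrCA lerDl.
    by rewrite addr_ge0// mulr_ge0// g0.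
  have st : stays X a b n%:R w by case.
  rewrite !indicE (mem_set st) mulr1 (@le_trans _ _ C)//.
    have [|Dz zE] := @dom_fine _ l r (X n%:R w).
      by move/andP: Xn => [aX Xb]; rewrite (lt_trans la)// (lt_trans Xb).
    by apply: gmax => //; move: Xn; rewrite zE !lte_fin => /andP[/ltW -> /ltW ->].
  by rewrite lerDr addr_ge0// mulr_ge0// g0.
have lim0 : (g x)%:E <= (g a * pa + g b * pb)%:E.
  have cvgS := @stays_cvg _ _ _ _ _ _ _ _ hX x a b.
  rewrite (exit_interval hX hs Da Dx Db axb) in cvgS.
  have cvgC : (g a * pa + g b * pb)%:E + C%:E * P x (stays X a b n%:R) @[n --> \oo]
     --> (g a * pa + g b * pb)%:E + C%:E * 0.
    apply: cvgeD; [by rewrite mule0 fin_num_adde_defl|exact: cvg_cst|exact: cvgeZl].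
  rewrite mule0 adde0 in cvgC.
  rewrite -(cvg_lim (@ereal_hausdorff R) cvgC); apply: lime_ge.
    by apply/cvg_ex; eexists; exact: cvgC.
  by apply: nearW.
move: lim0; rewrite lee_fin.
have := hits_before_prob_up hX hs Da Db axb; rewrite -pbE => -[->].
have := hits_before_prob hX hs Dx Da Db (or_intror axb); rewrite -paE => -[->].
have sab : (0 < s b - s a)%R by rewrite subr_gt0 (scale_incr hs).
set q := (s b - s a)%R in sab *; set e := (X in (_ <= X)%R -> _) => h.
apply: (@le_trans _ _ (e * q)%R); first by rewrite ler_pM2r.
suff -> : (e * q = g a * (s b - s x) + g b * (s x - s a))%R by [].
by rewrite /e /q; field; rewrite gt_eqF.
Qed.

End BoundaryAndConvexity.

(** * Limits at the boundary *)

Section BoundaryLimits.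
Variables (R : realType) (l r : \bar R).
Local Notation D := (dom l r).
Local Notation Dbar := [set z : \bar R | l < z < r].
Implicit Types f : R -> R.

Lemma left_boundary_proper u : D u -> ProperFilter (within Dbar (nbhs l)).
Proof.
move=> Du; apply: Build_ProperFilter_ex => U nU.
suff [z [lz zr Uz]] : exists z, [/\ l < z, z < r & Dbar z -> U z].
  by exists z; apply: Uz; rewrite /= lz zr.
have /andP[lu ur] := Du; move: nU; rewrite /within/=.
case: (l) lu => [a| |] lu; last 1 first.
- move=> [M [_ hM]]; pose z := Num.min (M - 1)%R u.
  exists z%:E; split; first by rewrite ltNyr.
    by rewrite (le_lt_trans _ ur)// lee_fin ge_min lexx orbT.
  by apply: hM; rewrite lte_fin gt_min; apply/orP; left; lra.
- move=> /nbhs_EFin/nbhs_ballP[e /= e0 he]; rewrite lte_fin in lu.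
  pose z := Num.min (a + e / 2)%R u.
  have az : (a < z)%R by rewrite lt_min lu andbT; lra.
  have zae : (z <= a + e / 2)%R by rewrite ge_min lexx.
  exists z%:E; split; first by rewrite lte_fin.
    by rewrite (le_lt_trans _ ur)// lee_fin ge_min lexx orbT.
  by apply: he; rewrite /ball/= ltr0_norm ?subr_lt0//; lra.
- by move: lu; rewrite ltNge leey.
Qed.

Lemma right_boundary_proper u : D u -> ProperFilter (within Dbar (nbhs r)).
Proof.
move=> Du; apply: Build_ProperFilter_ex => U nU.
suff [z [lz zr Uz]] : exists z, [/\ l < z, z < r & Dbar z -> U z].
  by exists z; apply: Uz; rewrite /= lz zr.
have /andP[lu ur] := Du; move: nU; rewrite /within/=.
case: (r) ur => [a| |] ur.
- move=> /nbhs_EFin/nbhs_ballP[e /= e0 he]; rewrite lte_fin in ur.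
  pose z := Num.max (a - e / 2)%R u.
  have za : (z < a)%R by rewrite gt_max ur andbT; lra.
  have zae : (a - e / 2 <= z)%R by rewrite le_max lexx.
  exists z%:E; split; last 2 first.
  + by rewrite lte_fin.
  + by apply: he; rewrite /ball/= gtr0_norm ?subr_gt0//; lra.
  by rewrite (lt_le_trans lu)// lee_fin le_max lexx orbT.
- move=> [M [_ hM]]; pose z := Num.max (M + 1)%R u.
  exists z%:E; split; last 2 first.
  + by rewrite ltry.
  + by apply: hM; rewrite lte_fin lt_max; apply/orP; left; lra.
  by rewrite (lt_le_trans lu)// lee_fin le_max lexx orbT.
- by move: ur; rewrite ltNge leNye.
Qed.

Lemma near_left_boundary a : D a ->
  \forall z \near within Dbar (nbhs l), D (fine z) /\ (fine z <= a)%R.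
Proof.
move=> Da; have /andP[la _] := Da; rewrite near_withinE.
have : nbhs l [set z | z < a%:E].
  by apply: open_nbhs_nbhs; split => //; exact: open_ereal_lt_ereal.
apply: filterS => z /= za zD; have [Dz zE] := dom_fine zD; split=> //.
by rewrite -lee_fin -zE ltW.
Qed.

Lemma near_right_boundary a : D a ->
  \forall z \near within Dbar (nbhs r), D (fine z) /\ (a <= fine z)%R.
Proof.
move=> Da; have /andP[_ ar] := Da; rewrite near_withinE.
have : nbhs r [set z | a%:E < z].
  by apply: open_nbhs_nbhs; split => //; exact: open_ereal_gt_ereal.
apply: filterS => z /= za zD; have [Dz zE] := dom_fine zD; split=> //.
by rewrite -lee_fin -zE ltW.
Qed.

(** Stated along an arbitrary filter, to serve at either boundary and for either
monotonicity. *)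
Lemma eventually_below_cvg (T : Type) (G : set_system T) (FG : Filter G) (h : T -> R) f u :
  D u ->
  (forall a, D a -> \forall z \near G, exists2 b, D b & h z = f b /\ (f b <= f a)%R) ->
  (h z)%:E @[z --> G] --> ereal_inf [set (f a)%:E | a in D].
Proof.
move=> Du below; set m := ereal_inf _.
have m_le a : D a -> m <= (f a)%:E by move=> Da; apply: ereal_inf_lbound; exists a.
case mE : m m_le => [c| |] m_le; last 2 first.
- by have := m_le u Du.
- apply/cvgeNyPle => M.
  have : m < M%:E by rewrite mE ltNyr.
  move=> /ereal_inf_lt[_ [a Da <-]] faM; apply: filterS (below a Da) => z [b Db [-> fba]].
  by rewrite (le_trans _ (ltW faM))// lee_fin.
apply: cvg_EFin; first exact: nearW.
apply/cvgrPdist_lt => e e0.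
have : m < (c + e)%:E by rewrite mE lte_fin ltrDl.
move=> /ereal_inf_lt[_ [a Da <-]]; rewrite lte_fin => face.
apply: filterS (below a Da) => z [b Db [/= -> fba]].
have := m_le b Db; rewrite lee_fin => cfb.
by rewrite ltr_norml; apply/andP; split; lra.
Qed.

Lemma eventually_above_cvg (T : Type) (G : set_system T) (FG : Filter G) (h : T -> R) f u :
  D u ->
  (forall a, D a -> \forall z \near G, exists2 b, D b & h z = f b /\ (f a <= f b)%R) ->
  (h z)%:E @[z --> G] --> ereal_sup [set (f a)%:E | a in D].
Proof.
move=> Du above.
have -> : ereal_sup [set (f a)%:E | a in D] = - ereal_inf [set (- f a)%:E | a in D].
  rewrite ereal_supEN; congr (- ereal_inf _); apply/seteqP; split.
    by move=> _ [_ [a Da <-] <-]; exists a.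
  by move=> _ [a Da <-]; exists (f a)%:E => //; exists a.
have -> : (fun z => (h z)%:E) = (fun z => - (- h z)%:E).
  by apply/funext => z; rewrite EFinN oppeK.
apply: cvgeN; apply: (@eventually_below_cvg _ _ _ (fun z => - h z)%R (fun a => - f a)%R _ Du).
move=> a Da; apply: filterS (above a Da) => z [b Db [-> fab]].
by exists b; rewrite // lerN2.
Qed.

Lemma ext_left_boundary u f (L : \bar R) : D u ->
  (f (fine z))%:E @[z --> within Dbar (nbhs l)] --> L -> ext l r f l = L.
Proof.
move=> Du cvgL; rewrite /ext ltxx /=.
have := left_boundary_proper Du => PF.
exact: (cvg_lim (@ereal_hausdorff R) cvgL).
Qed.

Lemma ext_right_boundary u f (L : \bar R) : D u ->
  (f (fine z))%:E @[z --> within Dbar (nbhs r)] --> L -> ext l r f r = L.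
Proof.
move=> Du cvgL; rewrite /ext ltxx andbF /=.
have := right_boundary_proper Du => PF.
exact: (cvg_lim (@ereal_hausdorff R) cvgL).
Qed.

Lemma ext_left_nondecr u f : D u ->
  (forall a b, D a -> D b -> (a <= b)%R -> (f a <= f b)%R) ->
  ext l r f l = ereal_inf [set (f a)%:E | a in D].
Proof.
move=> Du mono; apply: (ext_left_boundary Du).
apply: (@eventually_below_cvg _ _ _ (f \o @fine R) f u Du) => a Da.
apply: filterS (near_left_boundary Da) => z [Dz za].
by exists (fine z) => //; split=> //; exact: mono.
Qed.

Lemma ext_right_nondecr u f : D u ->
  (forall a b, D a -> D b -> (a <= b)%R -> (f a <= f b)%R) ->
  ext l r f r = ereal_sup [set (f a)%:E | a in D].
Proof.
move=> Du mono; apply: (ext_right_boundary Du).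
apply: (@eventually_above_cvg _ _ _ (f \o @fine R) f u Du) => a Da.
apply: filterS (near_right_boundary Da) => z [Dz za].
by exists (fine z) => //; split=> //; exact: mono.
Qed.

Lemma ext_left_nonincr u f : D u ->
  (forall a b, D a -> D b -> (a <= b)%R -> (f b <= f a)%R) ->
  ext l r f l = ereal_sup [set (f a)%:E | a in D].
Proof.
move=> Du mono; apply: (ext_left_boundary Du).
apply: (@eventually_above_cvg _ _ _ (f \o @fine R) f u Du) => a Da.
apply: filterS (near_left_boundary Da) => z [Dz za].
by exists (fine z) => //; split=> //; exact: mono.
Qed.

Lemma ext_right_nonincr u f : D u ->
  (forall a b, D a -> D b -> (a <= b)%R -> (f b <= f a)%R) ->
  ext l r f r = ereal_inf [set (f a)%:E | a in D].
Proof.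
move=> Du mono; apply: (ext_right_boundary Du).
apply: (@eventually_below_cvg _ _ _ (f \o @fine R) f u Du) => a Da.
apply: filterS (near_right_boundary Da) => z [Dz za].
by exists (fine z) => //; split=> //; exact: mono.
Qed.

End BoundaryLimits.

(** * Image measures and null sections *)

Section ImageMeasure.
Variables (R : realType) (E : set R) (q : R -> R).
Hypotheses (mE : measurable E) (mq : measurable_fun E q).

Lemma extended_measurable (x0 : R) :
  measurable_fun setT (fun p => if p \in E then q p else x0).
Proof.
have EE : (fun p => p \in E) @^-1` [set true] = E.
  by apply/seteqP; split => p; [exact: set_mem|exact: mem_set].
apply: measurable_fun_if => //.
- by apply: (measurable_fun_bool true); rewrite setTI EE.
- by rewrite setTI EE.
Qed.

(** Outside E, where no mass is placed, q is replaced by a constant to obtain a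
function measurable on the whole line. *)
Lemma image_measure (x0 : R) : exists mu : {measure set (\bar R) -> \bar R},
  (forall A, mu A = lebesgue_measure (E `&` [set p | A (q p)%:E])) /\
  (forall A (H : \bar R -> \bar R), measurable A -> measurable_fun A H ->
    (forall y, A y -> 0 <= H y) -> (forall p, E p -> A (q p)%:E) ->
    \int[mu]_(y in A) H y = \int[lebesgue_measure]_(p in E) H (q p)%:E).
Proof.
pose f (p : measurableTypeR R) := (if p \in E then q p else x0)%:E.
have mf : measurable_fun setT f.
  by apply/measurable_EFinP; exact: extended_measurable.
pose nu : {measure set (measurableTypeR R) -> \bar R} := mrestr lebesgue_measure mE.
exists (measure_function_pushforward__canonical__measure_function_Measure nu mf).
have fE p : E p -> f p = (q p)%:E by move=> Ep; rewrite /f mem_set.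
split.
  move=> A; rewrite /= /pushforward /nu /= /mrestr; congr lebesgue_measure.
  by apply/seteqP; split => p [h1 h2]; split => //=; move: h1 h2; rewrite /preimage/= => h1 h2; rewrite -?fE// fE.
move=> A H mA mH H0 EA.
rewrite (ge0_integral_pushforward mf nu mA mH); last by move=> y /set_mem; exact: H0.
set B := f @^-1` A.
have EB : E `<=` B by move=> p Ep; rewrite /B /preimage/= fE//; exact: EA.
have mB : measurable B by rewrite -[B]setTI; exact: mf.
have mHf : measurable_fun B (H \o f).
  apply: (measurable_comp mA _ mH); last exact: measurable_funTS.
  by move=> _ [p Bp <-].
rewrite -(setDUK EB) ge0_integral_setU//; first last.
- by rewrite disj_set2E setDIK.
- by move=> p; rewrite setDUK// => Bp; exact: H0.
- by rewrite setDUK.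
- exact: measurableD.
rewrite (null_set_integral (measurableD mB mE)); first last.
- by rewrite /nu /= /mrestr setIC setDIK measure0.
- by apply: measurable_funS mHf.
rewrite adde0; transitivity (\int[lebesgue_measure]_(p in E) (H \o f) p).
  by apply: eq_measure_integral => A' mA' A'E; rewrite /nu /= /mrestr setIidl.
by apply: eq_integral => p /set_mem Ep; rewrite /= fE.
Qed.

End ImageMeasure.

Lemma null_sections d1 d2 (T1 : measurableType d1) (T2 : measurableType d2)
    (R : realType) (m1 : {sigma_finite_measure set T1 -> \bar R})
    (m2 : {sigma_finite_measure set T2 -> \bar R}) (N : set (T1 * T2)) :
  measurable N -> (forall p, m2 (xsection N p) = 0) ->
  {ae m2, forall w, m1 (ysection N w) = 0}.
Proof.
move=> mN N0; have := indic_fubini_tonelli m1 m2 mN.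
rewrite indic_fubini_tonelli_FE// indic_fubini_tonelli_GE//.
rewrite integral0_eq => [int0|p _]; last exact: N0.
have mG := measurable_fun_ysection m1 mN.
have abs0 : \int[m2]_(w in setT) `|(m1 \o ysection N) w| = 0.
  by rewrite [RHS]int0; apply: eq_integral => w _; rewrite gee0_abs//=.
have := (ae_eq_integral_abs m2 measurableT mG).1 abs0.
by apply: filterS => w /(_ I).
Qed.

Lemma right_limit_unique (R : realType) (f1 f2 : R -> R) (t : R) :
  f1 u @[u --> t^'+] --> f1 t -> f2 u @[u --> t^'+] --> f2 t ->
  (forall q : rat, (t < ratr q)%R -> f1 (ratr q) = f2 (ratr q)) -> f1 t = f2 t.
Proof.
move=> c1 c2 f12; apply/eqP; rewrite -subr_eq0; apply/negP => /negP ne.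
have e0 : (0 < `|f1 t - f2 t| / 2)%R by rewrite divr_gt0// normr_gt0.
have h1 : \forall u \near t^'+, (`|f1 t - f1 u| < `|f1 t - f2 t| / 2)%R.
  by move/cvgrPdist_lt : c1 => /(_ _ e0).
have h2 : \forall u \near t^'+, (`|f2 t - f2 u| < `|f1 t - f2 t| / 2)%R.
  by move/cvgrPdist_lt : c2 => /(_ _ e0).
have [k k0 hk] : exists2 k : R, (0 < k)%R & forall u, (t < u < t + k)%R ->
    (`|f1 t - f1 u| < `|f1 t - f2 t| / 2)%R /\ (`|f2 t - f2 u| < `|f1 t - f2 t| / 2)%R.
  move: h1 h2; rewrite /at_right !near_withinE.
  move=> /nbhs_ballP[k1 /= k10 hk1] /nbhs_ballP[k2 /= k20 hk2].
  exists (Num.min k1 k2); first by rewrite lt_min k10.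
  move=> u /andP[tu utk]; have : (u - t < Num.min k1 k2)%R by lra.
  rewrite lt_min => /andP[u1 u2].
  by split; [apply: hk1|apply: hk2] => //; rewrite /ball/= ltr0_norm ?subr_lt0// opprB.
have tk : (t < t + k)%R by rewrite ltrDl.
have [q] := rat_in_itvoo tk; rewrite in_itv/= => tq.
have [h3 h4] := hk _ tq; have f12q := f12 q (proj1 (andP tq)).
rewrite f12q in h3.
have : (`|f1 t - f2 t| <= `|f1 t - f2 (ratr q)| + `|f2 t - f2 (ratr q)|)%R.
  by rewrite (distrC (f2 t)); exact: ler_distD.
lra.
Qed.

(** * The integral representation *)

Section Representation.
Variables (R : realType) (d : measure_display) (Omega : measurableType d).
Variables (l r : \bar R) (X : R -> Omega -> \bar R).
Variables (theta : R -> Omega -> Omega) (P : R -> probability Omega R).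
Hypothesis hX : regular_diffusion l r X theta P.
Implicit Types (t u v a b y z : R) (w : Omega).
Local Notation D := (dom l r).
Local Notation Dbar := [set z : \bar R | l < z < r].
Variable phi : R -> R -> R.
Hypothesis no_return : forall y z, D y -> D z ->
  P z (~` hits_after X y 0) = (phi y z)%:E.
Hypothesis phi_measurable : measurable_fun (D `*` D) (fun yz : R * R => phi yz.1 yz.2).
Hypothesis phi_continuous : forall y z, D y -> D z -> phi y u @[u --> z] --> phi y z.
Variables (x : R) (Z : R -> R -> Omega -> R).
Hypothesis Dx : D x.
Hypothesis hZ : azema_submartingales l r X P x Z.
Variables (g : R -> R) (c : R) (E : set R) (q : R -> R).
Hypothesis hg : superposition D phi g c E q.
Local Notation Phi := (boundary_one l r).

Lemma measurable_dom : measurable (D : set R).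
Proof. by apply: is_interval_measurable; exact: dom_interval. Qed.

Lemma measurable_Dbar : measurable Dbar.
Proof.
rewrite (_ : Dbar = [set` `]l, r[]); first exact: emeasurable_itv.
by apply/seteqP; split => p; rewrite /= in_itv.
Qed.

(** On absorption the process becomes constant, so that only the continuity of
phi y in the interior matters. *)
Lemma path_right_continuous y t w : D y -> (0 <= t)%R ->
  Phi (phi y) (X u w) @[u --> t^'+] --> Phi (phi y) (X t w).
Proof.
move=> Dy t0; have [bd|Xt] := boundary_or_interior hX w t0.
  apply: cvg_near_cst; near=> u; rewrite (diff_absorbing hX (u := t))// t0/= ltW//.
have [Dz zE] := dom_fine Xt.
have cX : X u w @[u --> t^'+] --> X t w.
  have /subspace_continuousP/(_ t t0) := @Defs.diff_continuous _ _ _ _ _ _ _ _ hX w.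
  move=> h U nU; apply: (@filterS _ (nbhs t) _ _ _ _ (h U nU)) => u hu tu.
  by apply: hu; rewrite /= ltW// (le_lt_trans t0).
have cphi : phi y (fine (X u w)) @[u --> t^'+] --> phi y (fine (X t w)).
  have cX' : X u w @[u --> t^'+] --> (fine (X t w))%:E by rewrite -zE.
  exact: cvg_comp (fine_cvg cX') (phi_continuous Dy Dz).
rewrite [X in _ --> X]/boundary_one Xt; apply: cvg_trans cphi.
apply: near_eq_cvg; near=> u; rewrite /boundary_one.
suff -> : l < X u w < r by [].
near: u; apply: (cX [set z | l < z < r]).
by apply: open_nbhs_nbhs; split => //; exact: open_interval.
Unshelve. all: by end_near. Qed.

Let q' p := if p \in E then q p else x.

Lemma q'_dom p : D (q' p).
Proof.
have [_ _ qD _ _] := hg; rewrite /q'; case: ifPn => // /set_mem.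
exact: qD.
Qed.

Lemma q'_measurable : measurable_fun setT q'.
Proof. by have [mE mq _ _ _] := hg; exact: extended_measurable. Qed.

Lemma Z_measurable t : (0 <= t)%R ->
  measurable_fun setT (fun pw : R * Omega => Z (q' pw.1) t pw.2).
Proof.
move=> t0; have [_ _ /(_ t t0) mZ] := hZ.
apply: (measurable_comp (F := D `*` setT) (f := fun yw : R * Omega => Z yw.1 t yw.2)
  (g := fun pw : R * Omega => (q' pw.1, pw.2))) => //.
- by apply: measurableX => //; exact: measurable_dom.
- by move=> _ [pw _ <-]; split => //; exact: q'_dom.
- apply: measurable_fun_pair => //; apply: measurableT_comp => //; exact: q'_measurable.
Qed.

Lemma Phi_measurable t : (0 <= t)%R ->
  measurable_fun setT (fun pw : R * Omega => Phi (phi (q' pw.1)) (X t pw.2)).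
Proof.
move=> t0.
have mX : measurable_fun setT (fun pw : R * Omega => X t pw.2).
  by apply: measurableT_comp => //; exact: (measurable_path hX).
apply: (@boundary_one_comp_measurable _ l r _ _ (fun z (pw : R * Omega) => phi (q' pw.1) z)
  (fun pw => X t pw.2)) => //.
apply: (measurable_comp (F := D `*` D) (f := fun yz : R * R => phi yz.1 yz.2)
  (g := fun pw : R * Omega => (q' pw.1, fine (X t pw.2)))) => //.
- by apply: measurableX; exact: measurable_dom.
- by move=> _ [pw /dom_fine[Dz _] <-]; split => //; exact: q'_dom.
apply: measurable_funTS; apply: measurable_fun_pair.
  by apply: measurableT_comp => //; exact: q'_measurable.
by apply: measurableT_comp.
Qed.

Definition mismatch t : set (R * Omega) :=
  [set pw | E pw.1 /\ Z (q' pw.1) t pw.2 <> Phi (phi (q' pw.1)) (X t pw.2)].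

Lemma measurable_mismatch t : (0 <= t)%R -> measurable (mismatch t).
Proof.
move=> t0; have [mE _ _ _ _] := hg.
have mEq := measurable_fun_eqr (Z_measurable t0) (Phi_measurable t0).
have m1 : measurable ((fun pw : R * Omega => Z (q' pw.1) t pw.2 ==
    Phi (phi (q' pw.1)) (X t pw.2)) @^-1` [set false]).
  by rewrite -[X in measurable X]setTI; exact: mEq.
have m2 : measurable (E `*` [set: Omega]) by exact: measurableX.
rewrite (_ : mismatch t = (E `*` setT) `&` ((fun pw : R * Omega =>
  Z (q' pw.1) t pw.2 == Phi (phi (q' pw.1)) (X t pw.2)) @^-1` [set false])).
  exact: measurableI.
apply/seteqP; split => pw /=.
  by move=> [Ep ne]; split => //; apply/negbTE/eqP.
by move=> [[Ep _] /negbT/eqP].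
Qed.

(** At each rational time the two versions agree almost everywhere on the product
of E with the probability space, hence by Fubini, almost surely, at almost every
height; right-continuity extends this to all times. *)
Lemma ae_match : {ae P x, forall w, forall t, (0 <= t)%R ->
  lebesgue_measure.-negligible [set p | E p /\ Z (q p) t w <> Phi (phi (q p)) (X t w)]}.
Proof.
have [hZ1 hZ2 _] := hZ; have [_ _ qD _ _] := hg.
have at_rat (k : rat) : {ae P x, forall w, (0 <= k)%R ->
    lebesgue_measure (ysection (mismatch (ratr k)) w) = 0}.
  have [k0|_] := boolP (0 <= k)%R; last by apply: aeW.
  have k0' : (0 <= ratr k :> R)%R by rewrite ler0q.
  have := @null_sections _ _ _ _ R lebesgue_measure (P x) (mismatch (ratr k))
    (measurable_mismatch k0').
  move=> h; have : {ae P x, forall w, lebesgue_measure (ysection (mismatch (ratr k)) w) = 0}.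
    apply: h => p.
    have mS : measurable (xsection (mismatch (ratr k)) p).
      by apply: measurable_xsection; exact: measurable_mismatch.
    apply/negligibleP => //.
    apply: negligibleS (azema_ae hX no_return Dx (q'_dom p) k0' (hZ1 _ _ (q'_dom p) k0')).
    by move=> w; rewrite /xsection /= => /set_mem[].
  by apply: filterS.
have := ae_forall_countable at_rat; apply: filterS => w hw t t0.
pose U (k : rat) : set (measurableTypeR R) :=
  if (0 <= k)%R then ysection (mismatch (ratr k)) w else set0.
apply: (@negligibleS _ _ _ lebesgue_measure (\bigcup_k U k)).
  move=> p [Ep ne]; apply: contrapT => nU; apply: ne.
  have Dq := qD _ Ep.
  apply: (@right_limit_unique _ (fun u => Z (q p) u w)
    (fun u => Phi (phi (q p)) (X u w)) t (hZ2 _ _ w Dq t0)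
    (@path_right_continuous (q p) t w Dq t0)) => k tk.
  apply: contrapT => ne; apply: nU; have k0 : (0 <= k)%R by rewrite -(ler0q R) (le_trans t0)// ltW.
  by exists k => //; rewrite /U k0 /ysection /= inE /mismatch /= /q' mem_set.
apply: negligible_bigcup_countable => k; rewrite /U; case: ifPn => k0; last exact: negligible_set0.
have k0' : (0 <= ratr k :> R)%R by rewrite ler0q.
apply/negligibleP; last exact: hw.
by apply: measurable_ysection; exact: measurable_mismatch.
Qed.

(** Before absorption the identity is the superposition formula for g at X t;
afterwards the integrand is 1 and the formula gives the supremum of g, the limit
of g at the boundary point which the diffusion can reach. *)
Lemma representation (bad : \bar R) :
  {ae P x, forall w, forall t, (0 <= t)%R -> X t w <> bad} ->
  (forall b : \bar R, b = l \/ b = r -> b <> bad ->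
    ext l r g b = ereal_sup [set (g z)%:E | z in D]) ->
  exists mu : {measure set (\bar R) -> \bar R},
     [/\ radon l r mu, mu [set l; r] = 0 &
       {ae P x, forall w, forall t : R, (0 <= t)%R ->
          ext l r g (X t w) =
          c%:E + \int[mu]_(y in Dbar) (Z (fine y) t w)%:E}].
Proof.
move=> nbad ext_b; have [mE mq qD fin_E [rep total]] := hg.
have [mu [muE mu_int]] := image_measure mE mq x; exists mu; split.
- move=> K cK KD; have [K0|K0] := pselect (K !=set0); last first.
    rewrite (_ : K = set0) ?measure0//.
    by apply/seteqP; split => // z Kz; apply: K0; exists z.
  have [a [b [Da Db ab]]] := compact_in_dom K0 cK KD.
  have mKR : measurable [set y : R | K y%:E].
    apply: closed_measurable; apply: (@closed_comp _ _ (@EFin R) K).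
      by move=> y _; apply: cvg_EFin => //; exact: nearW.
    exact: (compact_closed (@ereal_hausdorff R) cK).
  have mab : measurable [set y : R | (a <= y <= b)%R].
    rewrite (_ : [set y | _] = [set` `[a, b]]); first exact: measurable_itv.
    by apply/seteqP; split => y; rewrite /= in_itv.
  rewrite muE; apply: le_lt_trans (fin_E _ _ Da Db).
  apply: le_measure; rewrite ?inE.
  - exact: (mq mE _ mKR).
  - exact: (mq mE _ mab).
  - by move=> p [Ep /ab]; rewrite !lee_fin.
- rewrite muE (_ : E `&` _ = set0) ?measure0//; apply/seteqP; split => // p [Ep].
  by have := qD p Ep; rewrite /dom /= => /andP[lq qr] [] h; move: lq qr; rewrite h ltxx.
apply: filterS2 nbad ae_match => w nb match_w t t0.
have [_ _ /(_ t t0) mZ] := hZ.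
have mZw : measurable_fun Dbar (fun y : \bar R => Z (fine y) t w).
  apply: (measurable_comp (F := D `*` setT) (f := fun yw : R * Omega => Z yw.1 t yw.2)
    (g := fun y : \bar R => (fine y, w))) => //.
  - by apply: measurableX => //; exact: measurable_dom.
  - by move=> _ [z /dom_fine[Dz _] <-].
  - by apply: measurable_funTS; apply: measurable_fun_pair.
have mPw : measurable_fun Dbar (fun y : \bar R => Phi (phi (fine y)) (X t w)).
  rewrite /boundary_one; case Xt : (l < X t w < r); last exact: measurable_cst.
  have [Dz _] := dom_fine Xt.
  apply: (measurable_comp (F := D `*` D) (f := fun yz : R * R => phi yz.1 yz.2)
    (g := fun y : \bar R => (fine y, fine (X t w)))) => //.
  - by apply: measurableX => //; exact: measurable_dom.
  - by move=> _ [z /dom_fine[Dy _] <-].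
  - by apply: measurable_funTS; apply: measurable_fun_pair.
have -> : \int[mu]_(y in Dbar) (Z (fine y) t w)%:E =
    \int[mu]_(y in Dbar) (Phi (phi (fine y)) (X t w))%:E.
  apply: ae_eq_integral.
  - exact: measurable_Dbar.
  - exact/measurable_EFinP.
  - exact/measurable_EFinP.
  pose N := Dbar `&` ((fun y : \bar R => Z (fine y) t w == Phi (phi (fine y)) (X t w)) @^-1` [set false]).
  have mN : measurable N.
    by apply: (measurable_fun_eqr mZw mPw) => //; exact: measurable_Dbar.
  apply: (@negligibleS _ _ _ _ N).
    move=> y /= h; have [Dy ne] : Dbar y /\ Z (fine y) t w <> Phi (phi (fine y)) (X t w).
      split; last by move=> eq; apply: h => _ /=; rewrite eq.
      by apply: contrapT => nD; apply: h => /nD.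
    by split => //; apply/negbTE/eqP.
  have muN : mu N = 0.
    have mNR : measurable [set y : R | N y%:E].
      by rewrite -[X in measurable X]setTI; exact: EFin_measurable.
    have mEN : measurable (E `&` [set p | N (q p)%:E]) by exact: (mq mE _ mNR).
    rewrite muE; apply/negligibleP => //.
    by apply: negligibleS (match_w t t0) => p [Ep [_ /= /negbT/eqP ne]].
  exact/negligibleP.
rewrite mu_int; first last.
- by move=> p /qD.
- move=> y /dom_fine[Dy _]; rewrite lee_fin.
  by have /andP[] := boundary_one_bounds hX no_return (X t w) Dy.
- exact/measurable_EFinP.
- exact: measurable_Dbar.
have [bd|Xt] := boundary_or_interior hX w t0.
  rewrite ext_b//; last exact: nb.
  rewrite total; congr (_ + _); rewrite -[LHS]mul1e -integral_cst//.
  apply: eq_integral => p _; rewrite /boundary_one.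
  by case: bd => ->; rewrite ltxx ?andbF.
have [Dz zE] := dom_fine Xt.
rewrite /ext Xt rep//; congr (_ + _); apply: eq_integral => p _.
by rewrite /boundary_one Xt.
Qed.

End Representation.

(** * Transience and the finite end of the scale *)

Section Transience.
Variables (R : realType) (d : measure_display) (Omega : measurableType d).
Variables (l r : \bar R) (X : R -> Omega -> \bar R).
Variables (theta : R -> Omega -> Omega) (P : R -> probability Omega R).
Variable s : R -> R.
Hypothesis hX : regular_diffusion l r X theta P.
Hypothesis hs : scale_function l r X P s.
Implicit Types (a b u v y z : R).
Local Notation D := (dom l r).

Lemma nbhs_dom z : D z -> nbhs z D.
Proof.
move=> /andP[lz zr]; apply: (nbhs_interval lz zr) => y ly yr.
by rewrite /dom/= ly.
Qed.

Lemma scale_continuous z : D z -> s u @[u --> z] --> s z.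
Proof.
move=> Dz; case: hs => _ /subspace_continuousP/(_ z Dz) h _ U nU.
have hU : nbhs z (fun u => D u -> U (s u)) by exact: h.
suff : nbhs z (fun u => U (s u)) by [].
by apply: filterS (filterI hU (nbhs_dom Dz)) => u [hu Du]; exact: hu.
Qed.

Lemma escape_prob_continuous (S : R) y z : D z ->
  escape_prob s S y u @[u --> z] --> escape_prob s S y z.
Proof.
move=> Dz; have cs := scale_continuous Dz.
rewrite /escape_prob (_ : (fun u => Num.max 0 ((s u - s y) / (S - s y)))%R =
    (fun u => (0 + (s u - s y) / (S - s y) + `|0 - (s u - s y) / (S - s y)|) / 2)%R);
  last by apply/funext => u; rewrite maxr_absE.
rewrite maxr_absE.
have ch : ((s u - s y) / (S - s y))%R @[u --> z] --> ((s z - s y) / (S - s y))%R.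
  by apply: cvgM; [apply: cvgB => //|]; exact: cvg_cst.
apply: cvgM; last exact: cvg_cst.
apply: cvgD; first by apply: cvgD => //; exact: cvg_cst.
by apply: cvg_norm; apply: cvgB => //; exact: cvg_cst.
Qed.

Lemma escape_prob_measurable (S : R) :
  (forall u, D u -> (s u < S)%R) \/ (forall u, D u -> (S < s u)%R) ->
  measurable_fun (D `*` D) (fun yz : R * R => escape_prob s S yz.1 yz.2).
Proof.
move=> hS.
have iD : is_interval D by exact: dom_interval.
have mD : measurable (D : set R) by exact: is_interval_measurable.
have ms : measurable_fun D s.
  by apply: nondecreasing_on_measurable => // u v Du Dv; exact: (scale_nondecr hs).
have mV : measurable_fun D (fun y => (S - s y)^-1)%R.
  apply: nondecreasing_on_measurable => // u v Du Dv uv.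
  have := scale_nondecr hs Du Dv uv; case: hS => hS; have := hS u Du; have := hS v Dv.
    move=> sv su suv; rewrite lef_pV2 ?posrE ?subr_gt0//; lra.
  move=> sv su suv; rewrite lef_nV2 ?negrE ?subr_lt0//; lra.
have mDD : measurable (D `*` D : set (R * R)) by exact: measurableX.
have m1 (f : R -> R) : measurable_fun D f ->
    measurable_fun (D `*` D) (fun yz : R * R => f yz.1).
  move=> mf; apply: (measurable_comp (F := D)) mf _ => //.
    by move=> _ [yz [Dy _] <-].
  exact: measurable_funTS.
have m2 (f : R -> R) : measurable_fun D f ->
    measurable_fun (D `*` D) (fun yz : R * R => f yz.2).
  move=> mf; apply: (measurable_comp (F := D)) mf _ => //.
    by move=> _ [yz [_ Dz] <-].
  exact: measurable_funTS.
apply: measurable_maxr; first exact: measurable_cst.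
apply: measurable_funM; last exact: (m1 _ mV).
by apply: measurable_funB; [exact: m2|exact: m1].
Qed.

Lemma unbounded_recurrent :
  (forall M : R, exists2 u, D u & (s u < M)%R) ->
  (forall M : R, exists2 u, D u & (M < s u)%R) -> recurrent l r X P.
Proof.
move=> below above z y Dz Dy; rewrite hitting_time_finite.
have [zy|yz|<-] := ltgtP z y.
- exact: (hits_prob_one_above hX hs below).
- exact: (hits_prob_one_below hX hs above).
apply/le_anti/andP; split.
  by apply: probability_le1; exact: (measurable_hits hX).
have <- : P z (starts X z) = 1 by exact: (diff_start hX Dz).
apply: le_measure; rewrite ?inE.
- exact: (measurable_starts hX).
- exact: (measurable_hits hX).
- by move=> w X0; exists 0%R.
Qed.

(** Otherwise every point would be visited almost surely from every other one,
both from below and from above. *)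
Lemma transient_bounded_above : transient l r X P ->
  (forall M : R, exists2 u, D u & (s u < M)%R) ->
  exists S, (forall u, D u -> (s u < S)%R) /\
    (forall e : R, (0 < e)%R -> exists2 u, D u & (S - e < s u)%R).
Proof.
move=> htr below; have [M hM] : exists M, forall u, D u -> (s u <= M)%R.
  apply: contrapT => nM; apply: htr; apply: unbounded_recurrent => // M.
  apply: contrapT => nu; apply: nM; exists M => u Du; rewrite leNgt; apply/negP => Mu.
  by apply: nu; exists u.
have [u0 Du0 _] := below 0%R.
have sp : has_sup (s @` D).
  by split; [exists (s u0), u0|exists M => _ [u Du <-]; exact: hM].
exists (sup (s @` D)); split => [u Du|e e0].
  have [_ [v [_ Dv /andP[_ uv]]]] := dom_open Du.
  apply: (lt_le_trans (scale_incr hs Du Dv uv)).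
  by apply: sup_upper_bound => //; exists v.
by have [_ [u Du <-] h] := sup_adherent e0 sp; exists u.
Qed.

Lemma transient_bounded_below : transient l r X P ->
  (forall M : R, exists2 u, D u & (M < s u)%R) ->
  exists S, (forall u, D u -> (S < s u)%R) /\
    (forall e : R, (0 < e)%R -> exists2 u, D u & (s u < S + e)%R).
Proof.
move=> htr above; have [M hM] : exists M, forall u, D u -> (M <= s u)%R.
  apply: contrapT => nM; apply: htr; apply: unbounded_recurrent => // M.
  apply: contrapT => nu; apply: nM; exists M => u Du; rewrite leNgt; apply/negP => Mu.
  by apply: nu; exists u.
have [u0 Du0 _] := above 0%R.
have si : has_inf (s @` D).
  by split; [exists (s u0), u0|exists M => _ [u Du <-]; exact: hM].
exists (inf (s @` D)); split => [u Du|e e0].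
  have [v [_ [Dv _ /andP[vu _]]]] := dom_open Du.
  apply: (le_lt_trans _ (scale_incr hs Dv Du vu)).
  by apply: ge_inf; [case: si|exists v].
by have [_ [u Du <-] h] := inf_adherent e0 si; exists u.
Qed.

End Transience.

Lemma ereal_inf_approx (R : realType) (D : set R) (f : R -> R) u :
  D u -> (forall z, D z -> (0 <= f z)%R) ->
  exists c : R, [/\ ereal_inf [set (f z)%:E | z in D] = c%:E,
    (forall z, D z -> (c <= f z)%R) &
    (forall e : R, (0 < e)%R -> exists2 z, D z & (f z < c + e)%R)].
Proof.
move=> Du f0; set m := ereal_inf _.
have m0 : 0 <= m by apply: le_ereal_inf_tmp => _ [z Dz <-]; rewrite lee_fin f0.
have m_le z : D z -> m <= (f z)%:E by move=> Dz; apply: ereal_inf_lbound; exists z.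
have mE : (fine m)%:E = m.
  by rewrite fineK// fin_numE gt_eqF ?(lt_le_trans _ m0)// lt_eqF// (le_lt_trans (m_le u Du)) ?ltry.
exists (fine m); split => // [z Dz|e e0].
  by rewrite -lee_fin mE m_le.
have : m < (fine m + e)%:E by rewrite -{1}mE lte_fin ltrDl.
by move=> /ereal_inf_lt[_ [z Dz <-]]; rewrite lte_fin; exists z.
Qed.

Theorem theorem3p3 (R : realType) (l r : \bar R) (hlr : l < r)
    (d : measure_display) (Omega : measurableType d)
    (X : R -> Omega -> \bar R) (theta : R -> Omega -> Omega)
    (P : R -> probability Omega R) (s : R -> R)
    (hX : regular_diffusion l r X theta P)
    (hs : scale_function l r X P s)
    (htrans : transient l r X P)
    (x : R) (hx : dom l r x)
    (Z : R -> R -> Omega -> R)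
    (hZ : azema_submartingales l r X P x Z) :
  (ext l r s l = -oo ->
   forall g : R -> R, nonneg_subharmonic l r X P g ->
   (exists u v, [/\ dom l r u, dom l r v & g u <> g v]) ->
   {in dom l r &, {homo g : u v / (u <= v)%R}} ->
   exists mu : {measure set (\bar R) -> \bar R},
     [/\ radon l r mu, mu [set l; r] = 0 &
       {ae P x, forall w, forall t : R, (0 <= t)%R ->
          ext l r g (X t w) =
          ext l r g l + \int[mu]_(y in [set y | l < y < r]) (Z (fine y) t w)%:E}])
  /\
  (ext l r s r = +oo ->
   forall g : R -> R, nonneg_subharmonic l r X P g ->
   (exists u v, [/\ dom l r u, dom l r v & g u <> g v]) ->
   {in dom l r &, {homo g : u v / (u <= v)%R >-> (v <= u)%R}} ->
   exists mu : {measure set (\bar R) -> \bar R},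
     [/\ radon l r mu, mu [set l; r] = 0 &
       {ae P x, forall w, forall t : R, (0 <= t)%R ->
          ext l r g (X t w) =
          ext l r g r + \int[mu]_(y in [set y | l < y < r]) (Z (fine y) t w)%:E}]).
Proof.
have s_incr := scale_incr hs; have s_ivt := scale_ivt hs.
have s_mono := scale_nondecr hs.
split=> sbd g [gsub g0] _ gmono.
  have g_mono u v : dom l r u -> dom l r v -> (u <= v)%R -> (g u <= g v)%R.
    by move=> Du Dv; apply: gmono; rewrite inE.
  have below M : exists2 u, dom l r u & (s u < M)%R.
    have : ereal_inf [set (s u)%:E | u in dom l r] < M%:E.
      by rewrite -(ext_left_nondecr hx s_mono) sbd ltNyr.
    by move=> /ereal_inf_lt[_ [u Du <-]]; rewrite lte_fin; exists u.
  have [S [s_lt s_sup]] := transient_bounded_above hX hs htrans below.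
  have [c [cE c_le c_inf]] := ereal_inf_approx hx g0.
  have g_conv := subharmonic_scale_convex hX hs gsub g0.
  have hg := convex_superposition s_incr s_ivt s_lt s_sup below g_mono _ c_le c_inf.
  rewrite (ext_left_nondecr hx g_mono) cE.
  apply: (representation hX _ _ _ hx hZ (hg _)) => //.
  - by move=> y z Dy Dz; apply: (no_return_prob_right hX hs).
  - by apply: (escape_prob_measurable hs); left.
  - by move=> y z _ Dz; apply: (escape_prob_continuous hs).
  - apply: g_conv => a u b Da Db /andP[au ub]; rewrite le_max; apply/orP; right.
    by apply: g_mono => //; apply: (dom_interval Da Db); rewrite au.
  - apply: (unreachable_left hX hx) => q Dq xq.
    exact: (hits_prob_one_above hX hs below).
  - move=> b [->//|->] _; exact: (ext_right_nondecr hx).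
have g_mono u v : dom l r u -> dom l r v -> (u <= v)%R -> (g v <= g u)%R.
  by move=> Du Dv; apply: gmono; rewrite inE.
have above M : exists2 u, dom l r u & (M < s u)%R.
  have : M%:E < ereal_sup [set (s u)%:E | u in dom l r].
    by rewrite -(ext_right_nondecr hx s_mono) sbd ltry.
  by move=> /ereal_sup_gt[_ [u Du <-]]; rewrite lte_fin; exists u.
have [S [s_gt s_inf]] := transient_bounded_below hX hs htrans above.
have [c [cE c_le c_inf]] := ereal_inf_approx hx g0.
have g_conv := subharmonic_scale_convex hX hs gsub g0.
have [|E [q hg]] := convex_superposition_nonincreasing s_incr s_ivt s_gt s_inf above g_mono _ c_le c_inf.
  apply: g_conv => a u b Da Db /andP[au ub]; rewrite le_max; apply/orP; left.
  by apply: g_mono => //; apply: (dom_interval Da Db); rewrite au.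
rewrite (ext_right_nonincr hx g_mono) cE.
apply: (representation hX _ _ _ hx hZ hg) => //.
- by move=> y z Dy Dz; apply: (no_return_prob_left hX hs).
- by apply: (escape_prob_measurable hs); right.
- by move=> y z _ Dz; apply: (escape_prob_continuous hs).
- apply: (unreachable_right hX hx) => p Dp xp.
  exact: (hits_prob_one_below hX hs above).
- move=> b [->|->//] _; exact: (ext_left_nonincr hx).
Qed.
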